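(* For $(M,V)\in(0,\infty)^2$ put $\overline V=\frac{3V}{4\pi}$, $I=\frac{3\mathfrak{R}T_cM}{8\pi\sigma}$ and $\sigma_{\rm ratio}=\bar\sigma/\sigma$. Let $R_\dagger[M,V]$ be the unique positive root of the polynomial $$\mathbb P(x)=(\sigma_{\rm ratio}^3+1)x^9-3Ix^7+\overline Vx^6+3I^2x^5-3I\overline Vx^4-I^3x^3+3I^2\overline Vx^2-I^3\overline V ,$$ which satisfies $$\sqrt{\frac{3\mathfrak{R}T_cM}{8\pi\sigma}}\Big/\sqrt{1+\frac{\bar\sigma}{\sigma}}<R_\dagger[M,V]<\sqrt{\frac{3\mathfrak{R}T_cM}{8\pi\sigma}},$$ and let $$\rho_\dagger[M,V]=\frac{3M}{4\pi R_\dagger[M,V]^3}=\frac{2}{\mathfrak{R}T_c}\left(\frac{\sigma}{R_\dagger[M,V]}+\frac{\bar\sigma}{\left(R_\dagger[M,V]^3+\overline V\right)^{1/3}}\right).$$ Then the mapping $(M,V)\in(0,\infty)\times(0,\infty)\mapsto (R_\dagger[M,V],\rho_\dagger[M,V])$ is well defined and smooth, is a bijection onto the set of pairs (gas radius, gas density) of regular spherically symmetric equilibria of the approximate gas-liquid model described in the context, and any regular spherically symmetric equilibrium (time-independent) solution of that model is uniquely determined by the pair $(M,V)$ of its gas mass and liquid volume (with gas radius $R_\dagger[M,V]$ and gas density identically $\rho_\dagger[M,V]$).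
   Context: Constants: $\rho_l,\mu_l,\kappa,\mathfrak{c},\mathfrak{R},T_c,\sigma,\bar\sigma>0$ (liquid density, liquid viscosity, gas thermal conductivity, gas specific heat, gas constant, external temperature, inner and outer surface tension coefficients), $\gamma=1+\mathfrak{R}/\mathfrak{c}$. Approximate gas-liquid model. Unknowns: a bounded gas domain $\Omega_g(t)\subset\mathbb R^3$ surrounded by a bounded liquid domain $\Omega_l(t)$ with $|\Omega_l(t)|=V$; liquid velocity and pressure $\mathbf v_l,p_l$; gas density, velocity, pressure, temperature and entropy $\rho,\mathbf v_g,p_g,T_g,s$. The equations are: in $\Omega_l(t)$: $\rho_l(\partial_t\mathbf v_l+\mathbf v_l\cdot\nabla\mathbf v_l)-\mu_l\Delta\mathbf v_l+\nabla p_l=0$, $\operatorname{div}\mathbf v_l=0$, and liquid temperature $T_l\equiv T_c$; in $\Omega_g(t)$: $\partial_t\rho+\operatorname{div}(\rho\mathbf v_g)=0$, $p_g=p_g(t)$ (spatially constant), $\rho T_g(\partial_ts+\mathbf v_g\cdot\nabla s)=\operatorname{div}(\kappa\nabla T_g)$, $p_g=\mathfrak{R}T_g\rho$, $s=\mathfrak{c}\log(p_g/\rho^\gamma)$; on $\partial\Omega_g(t)$: $\mathbf v_l\cdot\boldsymbol\nu=\mathbf v_g\cdot\boldsymbol\nu=v_-$, $(p_g-p_l)\boldsymbol\nu+2\mu_l\boldsymbol\nu\cdot\mathbf D(\mathbf v_l)=-\sigma H\boldsymbol\nu$, $T_g=T_l$; on $\partial\Omega_l(t)\setminus\partial\Omega_g(t)$: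 $\mathbf v_l\cdot\boldsymbol\nu=v_+$, $-p_l\boldsymbol\nu+2\mu_l\boldsymbol\nu\cdot\mathbf D(\mathbf v_l)=\bar\sigma H\boldsymbol\nu$. Here $\boldsymbol\nu$ is the unit normal pointing out of the gas region (on $\partial\Omega_g$), resp. out of the whole gas-liquid region (on the outer boundary), $v_\mp$ are the normal velocities of the moving surfaces, $\mathbf D(\mathbf v)=(\nabla\mathbf v+\nabla\mathbf v^\top)/2$, and $H=-\overline\nabla\cdot\boldsymbol\nu$ with $\overline\nabla$ the tangential gradient (so $H=-2/R$ for a sphere of radius $R$). Spherically symmetric means: $\Omega_g(t)=B_{R(t)}$ and the gas-liquid region is $B_{\overline R(t)}$, both balls centered at the origin, with $\overline R=(R^3+\overline V)^{1/3}$; velocities are radial, $\mathbf v(x,t)=v(|x|,t)x/|x|$; all scalar unknowns are radial functions. The gas mass is $M=\int_{B_R}\rho\,dx$. ''Regular'' means classically smooth up to and including the origin, with $\rho>0$. *)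

(* Defs.v *)
From HB Require Import structures.
From mathcomp Require Import all_boot all_order all_algebra.
From mathcomp Require Import all_classical all_reals all_analysis.

Set Implicit Arguments.
Unset Strict Implicit.
Unset Printing Implicit Defensive.

Import Order.TTheory GRing.Theory Num.Theory.
Import numFieldNormedType.Exports.

Local Open Scope classical_set_scope.
Local Open Scope ring_scope.

(* The spaces V below are finite-dimensional (R^3 or R * R), where continuity
   of all iterated directional derivatives is the usual notion of C^n. *)
Section Smooth.
Context {R : realType} {V W : normedModType R}.

Fixpoint Cn_on (n : nat) (U : set V) (f : V -> W) : Prop :=
  (forall x, U x -> {for x, continuous f}) /\
  match n with
  | 0%N => True
  | m.+1 => forall v : V,
      (forall x, U x -> derivable f x v) /\ Cn_on m U (fun x => 'D_v f x)
  end.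

Definition smooth_on (U : set V) (f : V -> W) : Prop :=
  forall n, Cn_on n U f.

(* C^infty up to the boundary of A. Fields are total functions, so that only
   their restriction to the closure of A is meaningful. *)
Definition smooth_up_to_boundary (A : set V) (f : V -> W) : Prop :=
  exists U : set V, [/\ open U, closure A `<=` U & smooth_on U f].

End Smooth.

Section EuclideanSpace.
Context {R : realType}.
Local Notation E := 'rV[R]_3.

(* The library norm on 'rV is the sup norm; it induces the usual topology, but
   lengths and distances have to be measured by the Euclidean norm. *)
Definition dot (u v : E) : R := \sum_(i < 3) u ord0 i * v ord0 i.
Definition enorm (u : E) : R := Num.sqrt (dot u u).
Definition eball (r : R) : set E := [set x | enorm x < r].
Definition boundary (A : set E) : set E := closure A `\` interior A.

Definition partial {W : normedModType R} (i : 'I_3) (f : E -> W) (x : E) : W :=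
  'D_(delta_mx ord0 i) f x.
Definition grad (f : E -> R) (x : E) : E := \row_i partial i f x.
Definition div (v : E -> E) (x : E) : R :=
  \sum_(i < 3) partial i (fun y => v y ord0 i) x.
Definition laplacian {W : normedModType R} (f : E -> W) (x : E) : W :=
  \sum_(i < 3) partial i (partial i f) x.
(* (u . nabla) v *)
Definition advect (u v : E -> E) (x : E) : E :=
  \sum_(i < 3) u x ord0 i *: partial i v x.
Definition sym_grad (v : E -> E) (x : E) : 'M[R]_3 :=
  \matrix_(i, j) ((partial i (fun y => v y ord0 j) x +
                   partial j (fun y => v y ord0 i) x) / 2).

Definition lebesgue3 : {measure set _ -> \bar R} :=
  [the measure (measurableTypeR R * measurableTypeR R * measurableTypeR R)%type
     R of ((@lebesgue_measure R \x @lebesgue_measure R)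
             \x @lebesgue_measure R)%E].
Definition vec3 (p : (R * R) * R) : E :=
  \row_(i < 3) [:: p.1.1; p.1.2; p.2]`_i.
Definition volume (A : set E) : \bar R := lebesgue3 (vec3 @^-1` A).
Definition integral3 (A : set E) (f : E -> R) : \bar R :=
  (\int[lebesgue3]_(p in vec3 @^-1` A) (f (vec3 p))%:E)%E.

(* Geometry of a smooth (moving) boundary, read off the signed distance d,
   negative inside A: near the boundary, nu = grad d is the outer unit normal
   (extended constantly along normals), and the boundary of a moving A(t) has
   outward normal velocity - d_t d. *)
Definition set_distance (x : E) (A : set E) : R :=
  inf [set enorm (x - y) | y in A].
Definition signed_distance (A : set E) (x : E) : R :=
  set_distance x A - set_distance x (~` A).
Definition normal (A : set E) (x : E) : E := grad (signed_distance A) x.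
Definition normal_velocity (A : R -> set E) (t : R) (x : E) : R :=
  - derive1 (fun u : R => signed_distance (A u) x) t.

(* i-th component of the tangential gradient (1 - n n^T) grad *)
Definition tangential_partial (n : E) (i : 'I_3) (f : E -> R) (x : E) : R :=
  partial i f x - n ord0 i * dot n (grad f x).
Definition curvature (A : set E) (x : E) : R :=
  - \sum_(i < 3)
      tangential_partial (normal A x) i (fun y => normal A y ord0 i) x.

Definition radial_scalar (A : set E) (f : E -> R) : Prop :=
  exists g : R -> R, forall x, A x -> f x = g (enorm x).
Definition radial_vector (A : set E) (v : E -> E) : Prop :=
  exists g : R -> R, forall x, A x -> v x = (g (enorm x) / enorm x) *: x.

End EuclideanSpace.

Record constants (R : realType) := Constants {
  rho_l : R;
  mu_l : R;
  kappa : R;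
  spec_heat : R;
  gas_const : R;
  T_c : R;
  sigma : R;
  sigma_bar : R;
  rho_l_gt0 : 0 < rho_l;
  mu_l_gt0 : 0 < mu_l;
  kappa_gt0 : 0 < kappa;
  spec_heat_gt0 : 0 < spec_heat;
  gas_const_gt0 : 0 < gas_const;
  T_c_gt0 : 0 < T_c;
  sigma_gt0 : 0 < sigma;
  sigma_bar_gt0 : 0 < sigma_bar
}.

(* The gas pressure depends on time only, as the approximate model requires. *)
Record flow (R : realType) := Flow {
  gas : R -> set 'rV[R]_3;
  liquid : R -> set 'rV[R]_3;
  v_l : R -> 'rV[R]_3 -> 'rV[R]_3;
  p_l : R -> 'rV[R]_3 -> R;
  rho : R -> 'rV[R]_3 -> R;
  v_g : R -> 'rV[R]_3 -> 'rV[R]_3;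
  p_g : R -> R;
  T_g : R -> 'rV[R]_3 -> R;
  entropy : R -> 'rV[R]_3 -> R
}.

Section Model.
Context {R : realType} (c : constants R).
Local Notation E := 'rV[R]_3.

Definition gamma : R := 1 + gas_const c / spec_heat c.

Definition liquid_temperature (t : R) (x : E) : R := T_c c.

Definition region (f : flow R) (t : R) : set E :=
  closure (gas f t) `|` liquid f t.

Definition is_domain (A : set E) : Prop :=
  [/\ open A, connected A, A !=set0 & bounded_set A].

(* Openness of the region says that the liquid surrounds the gas: the closure
   of the gas domain lies in the interior of the gas-liquid region. *)
Definition admissible_domains (V : R) (f : flow R) (t : R) : Prop :=
  [/\ is_domain (gas f t) /\ is_domain (liquid f t),
      gas f t `&` liquid f t = set0,
      open (region f t) &
      volume (liquid f t) = V%:E].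

Definition liquid_equations (f : flow R) (t : R) (x : E) : Prop :=
  rho_l c *: (derive1 (fun u => v_l f u x) t + advect (v_l f t) (v_l f t) x)
    - mu_l c *: laplacian (v_l f t) x + grad (p_l f t) x = 0 /\
  div (v_l f t) x = 0.

Definition gas_equations (f : flow R) (t : R) (x : E) : Prop :=
  [/\ derive1 (fun u => rho f u x) t
        + div (fun y => rho f t y *: v_g f t y) x = 0,
      rho f t x * T_g f t x *
        (derive1 (fun u => entropy f u x) t
         + dot (v_g f t x) (grad (entropy f t) x))
        = div (fun y => kappa c *: grad (T_g f t) y) x,
      p_g f t = gas_const c * T_g f t x * rho f t x &
      entropy f t x = spec_heat c * ln (p_g f t / (rho f t x `^ gamma))].

Definition gas_boundary_conditions (f : flow R) (t : R) (x : E) : Prop :=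
  let nu := normal (gas f t) x in
  [/\ dot (v_l f t x) nu = normal_velocity (gas f) t x,
      dot (v_g f t x) nu = normal_velocity (gas f) t x,
      (p_g f t - p_l f t x) *: nu
        + (2 * mu_l c) *: (nu *m sym_grad (v_l f t) x)
        = - (sigma c * curvature (gas f t) x) *: nu &
      T_g f t x = liquid_temperature t x].

Definition outer_boundary_conditions (f : flow R) (t : R) (x : E) : Prop :=
  let nu := normal (region f t) x in
  dot (v_l f t x) nu = normal_velocity (region f) t x /\
  - p_l f t x *: nu + (2 * mu_l c) *: (nu *m sym_grad (v_l f t) x)
    = (sigma_bar c * curvature (region f t) x) *: nu.

(* Solutions with liquid volume V, for all times in R; the time interval is
   immaterial for equilibria. *)
Definition is_solution (V : R) (f : flow R) : Prop :=
  forall t, [/\ admissible_domains V f t,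
    forall x, liquid f t x -> liquid_equations f t x,
    forall x, gas f t x -> gas_equations f t x,
    forall x, boundary (gas f t) x -> gas_boundary_conditions f t x &
    forall x, (boundary (liquid f t) `\` boundary (gas f t)) x ->
      outer_boundary_conditions f t x].

Definition V_bar (V : R) : R := 3 * V / (4 * pi).
Definition outer_radius (V r : R) : R := (r ^+ 3 + V_bar V) `^ (3^-1).

Definition gas_radius (f : flow R) (t r : R) : Prop :=
  0 < r /\ gas f t = eball r.

Definition spherically_symmetric (V : R) (f : flow R) : Prop :=
  forall t,
  [/\ exists r, gas_radius f t r /\ region f t = eball (outer_radius V r),
      radial_vector (liquid f t) (v_l f t) /\
      radial_vector (gas f t) (v_g f t),
      radial_scalar (liquid f t) (p_l f t) &
      [/\ radial_scalar (gas f t) (rho f t),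
          radial_scalar (gas f t) (T_g f t) &
          radial_scalar (gas f t) (entropy f t)]].

(* Only spatial regularity is required: the notion is used for equilibria. *)
Definition regular (f : flow R) : Prop :=
  forall t,
  [/\ forall x, gas f t x -> 0 < rho f t x,
      smooth_up_to_boundary (liquid f t) (v_l f t) /\
      smooth_up_to_boundary (liquid f t) (p_l f t),
      smooth_up_to_boundary (gas f t) (rho f t),
      smooth_up_to_boundary (gas f t) (v_g f t) &
      smooth_up_to_boundary (gas f t) (T_g f t) /\
      smooth_up_to_boundary (gas f t) (entropy f t)].

Definition same_state (f : flow R) (t : R) (g : flow R) (u : R) : Prop :=
  [/\ gas f t = gas g u, liquid f t = liquid g u, p_g f t = p_g g u,
      forall x, closure (liquid f t) x ->
        v_l f t x = v_l g u x /\ p_l f t x = p_l g u x &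
      forall x, closure (gas f t) x ->
        [/\ rho f t x = rho g u x, v_g f t x = v_g g u x,
            T_g f t x = T_g g u x & entropy f t x = entropy g u x]].

Definition time_independent (f : flow R) : Prop :=
  forall t u, same_state f t f u.

Definition equilibrium (V : R) (f : flow R) : Prop :=
  [/\ is_solution V f, spherically_symmetric V f, regular f &
      time_independent f].

Definition gas_mass (f : flow R) (t : R) : \bar R :=
  integral3 (gas f t) (rho f t).

Definition gas_density (f : flow R) (t q : R) : Prop :=
  forall x, gas f t x -> rho f t x = q.

Definition equilibrium_pairs : set (R * R) :=
  [set q | exists V : R, exists f : flow R, [/\ 0 < V, equilibrium V f &
     forall t, gas_radius f t q.1 /\ gas_density f t q.2]].

Definition I_mass (M : R) : R :=
  3 * gas_const c * T_c c * M / (8 * pi * sigma c).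
Definition sigma_ratio : R := sigma_bar c / sigma c.

Definition radius_poly (M V : R) : {poly R} :=
  let I := I_mass M in let Vb := V_bar V in
  (sigma_ratio ^+ 3 + 1) *: 'X^9 - (3 * I) *: 'X^7 + Vb *: 'X^6
  + (3 * I ^+ 2) *: 'X^5 - (3 * I * Vb) *: 'X^4 - (I ^+ 3) *: 'X^3
  + (3 * I ^+ 2 * Vb) *: 'X^2 - (I ^+ 3 * Vb)%:P.

(* The positive root; 0 unless one exists. *)
Definition R_dag (M V : R) : R :=
  xget 0 [set x | 0 < x /\ root (radius_poly M V) x].

Definition rho_dag (M V : R) : R := 3 * M / (4 * pi * R_dag M V ^+ 3).

Definition dag_map (p : R * R) : R * R := (R_dag p.1 p.2, rho_dag p.1 p.2).

Definition quadrant : set (R * R) := [set p | 0 < p.1 /\ 0 < p.2].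

End Model.

(* Main.v *)
Require Import Defs.
From mathcomp Require Import all_boot all_order all_algebra.
From mathcomp Require Import all_classical all_reals all_analysis.
From mathcomp Require Import measurable_realfun.
From mathcomp Require Import ring lra.

Set Implicit Arguments.
Unset Strict Implicit.
Unset Printing Implicit Defensive.

Import Order.TTheory GRing.Theory Num.Theory.
Import numFieldNormedType.Exports.

Local Open Scope classical_set_scope.
Local Open Scope ring_scope.

(** An equilibrium is a gas bubble and a liquid shell at rest, and for a given liquid
    volume [V] it is determined by the gas radius [R].

    Rigidity.  A stationary radial divergence-free field is a multiple of [x / |x| ^ 3], so it
    vanishes as soon as it does not cross one sphere ([radial_div_free_eq0]); this applies
    to the liquid velocity and to the mass flux of the gas.  The energy equation then makes
    the gas temperature harmonic, hence equal to its boundary value [T_c] by the maximum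
    principle ([harmonic_eq_boundary]); the state law makes the density constant, and the
    momentum equation makes the liquid pressure constant.  The stress conditions on the two
    spheres, of curvature [- 2 / R] and [- 2 / Rbar], reduce to the force balance
      [gas_const * T_c * rho = 2 sigma / R + 2 sigma_bar / Rbar],
    which fixes the density ([equilibrium_is_rest]).  Conversely these constants define an
    equilibrium for every [R > 0] ([rest_state_equilibrium]).

    Mass and volume.  By [M = 4 / 3 pi R ^ 3 rho], the force balance multiplied by
    [R ^ 3 / (2 sigma)] reads
      [R ^ 2 + sigma_ratio * R ^ 3 / Rbar = I].
    Its left-hand side increases from [0] to infinity with [R], so [M] and [V] determine [R].
    Clearing the cube root in [Rbar = (R ^ 3 + V_bar) ^ (1 / 3)] turns it into
      [sigma_ratio ^ 3 R ^ 9 + (R ^ 3 + V_bar) (R ^ 2 - I) ^ 3 = 0],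
    the polynomial of the statement in factored form ([radius_fun]).  In the other
    direction [R] and [rho] give [M], and then [V_bar], in which the equation is linear
    ([dag_map_inj]).

    Smoothness.  The root is transversal, so [R] and [Rbar] have directional derivatives in
    [(M, V)], and these are rational expressions in [R] and [Rbar] without poles
    ([is_derive_dag]).  Hence if [R] and [Rbar] are [C^n], so are their derivatives, and
    smoothness follows by induction ([Cn_on_dag]).

    The geometric input is that the signed distance to a ball is [|x| - r], from which the
    normal and the curvature are computed, that shells are connected, and that balls have
    volume [4 / 3 pi r ^ 3], obtained by slicing. *)

(** * The radius equation *)

Section RadiusEquation.
Context {R : realType}.
Implicit Types s I b x y : R.

(** The polynomial of the radius equation in the form it takes before expansion;
    [radius_polyE] relates the two. *)
Definition radius_fun s I b x : R :=
  s ^+ 3 * x ^+ 9 + (x ^+ 3 + b) * (x ^+ 2 - I) ^+ 3.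

Lemma radius_fun_gt0 s I b x :
  0 < s -> 0 < b -> 0 < x -> I <= x ^+ 2 -> 0 < radius_fun s I b x.
Proof.
move=> s0 b0 x0 Ix; apply: ltr_wpDr; last by rewrite mulr_gt0 ?exprn_gt0.
by rewrite mulr_ge0 ?addr_ge0 ?exprn_ge0 ?subr_ge0 ?(ltW b0) ?(ltW x0).
Qed.

Lemma radius_fun_divX9 s I b x : x != 0 ->
  radius_fun s I b x =
  x ^+ 9 * (s ^+ 3 - (1 + b / x ^+ 3) * (I / x ^+ 2 - 1) ^+ 3).
Proof. by move=> x0; rewrite /radius_fun; field. Qed.

(** After division by [x ^ 9] only [(1 + b / x ^ 3) * (I / x ^ 2 - 1) ^ 3] varies, and it
    decreases as long as [x ^ 2 < I].  So the sign can change only once, from negative to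
    positive, which gives uniqueness of the root and, later, its continuity. *)
Lemma radius_fun_sign_incr s I b x x' : 0 < s -> 0 < I -> 0 < b ->
  0 < x -> x < x' -> 0 <= radius_fun s I b x -> 0 < radius_fun s I b x'.
Proof.
move=> s0 I0 b0 x0 xx'.
have x'0 : 0 < x' by apply: lt_trans xx'.
have [Ix' _|x'I] := leP I (x' ^+ 2); first exact: radius_fun_gt0.
rewrite !radius_fun_divX9 ?gt_eqF// pmulr_rge0 ?pmulr_rgt0 ?exprn_gt0//.
rewrite subr_ge0 subr_gt0; apply: lt_le_trans.
have xx'n n : x ^+ n.+1 < x' ^+ n.+1 by rewrite ltrXn2r// ltW.
apply: ltr_pM.
- by rewrite addr_ge0// divr_ge0// ltW// exprn_gt0.
- by rewrite exprn_ge0// subr_ge0 ler_pdivlMr ?exprn_gt0// mul1r ltW.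
- by rewrite ltrD2l ltr_pM2l// ltf_pV2 ?posrE ?exprn_gt0.
- rewrite ltrXn2r//.
    by rewrite subr_ge0 ler_pdivlMr ?exprn_gt0// mul1r ltW.
  by rewrite ltrD2r ltr_pM2l// ltf_pV2 ?posrE ?exprn_gt0.
Qed.

(** With [y] the outer radius, [radius_fun] is the difference of the cubes of the two
    sides, and cubing loses nothing because the left-hand side is positive. *)
Lemma radius_fun_root_eq s I b x y : 0 < s -> 0 < x -> 0 < y ->
  y ^+ 3 = x ^+ 3 + b ->
  radius_fun s I b x = 0 <-> s * x ^+ 3 = y * (I - x ^+ 2).
Proof.
move=> s0 x0 y0 yE; split=> [h|h].
- have /eqP : (s * x ^+ 3) ^+ 3 = (y * (I - x ^+ 2)) ^+ 3.
    by rewrite [RHS]exprMn yE; move: h; rewrite /radius_fun => h; lra.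
  rewrite -subr_eq0.
  have -> : (s * x ^+ 3) ^+ 3 - (y * (I - x ^+ 2)) ^+ 3 =
    (s * x ^+ 3 - y * (I - x ^+ 2)) *
    ((s * x ^+ 3) ^+ 2 + (s * x ^+ 3) * (y * (I - x ^+ 2)) +
     (y * (I - x ^+ 2)) ^+ 2) by ring.
  rewrite mulf_eq0 => /orP[|]; first by rewrite subr_eq0 => /eqP.
  have : 0 < s * x ^+ 3 by rewrite mulr_gt0 ?exprn_gt0.
  set u := s * _; set v := y * _ => u0 /eqP e.
  by have := sqr_ge0 (v + u / 2); have := mulr_gt0 u0 u0; lra.
- have : (s * x ^+ 3) ^+ 3 = (y * (I - x ^+ 2)) ^+ 3 by rewrite h.
  by rewrite [RHS]exprMn yE /radius_fun => h'; lra.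
Qed.

(** This is the radius that would balance if the liquid layer had no thickness
    ([b = 0], [y = x]); a layer of positive volume pushes the root above it. *)
Lemma radius_fun_lower s I b x : 0 < s -> 0 < b -> 0 < x ->
  x ^+ 2 * (1 + s) = I -> radius_fun s I b x < 0.
Proof.
move=> s0 b0 x0 <-; have -> : radius_fun s (x ^+ 2 * (1 + s)) b x =
  - (b * s ^+ 3 * x ^+ 6) by rewrite /radius_fun; ring.
by rewrite oppr_lt0 !mulr_gt0 ?exprn_gt0.
Qed.

Lemma radius_polyE (c : constants R) M V x :
  (radius_poly c M V).[x] =
  radius_fun (sigma_ratio c) (I_mass c M) (V_bar V) x.
Proof.
rewrite /radius_poly /radius_fun; cbv zeta.
move: (sigma_ratio c) (I_mass c M) (V_bar V) => s I b.
by rewrite !(hornerD, hornerN, hornerZ, hornerXn, hornerC); ring.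
Qed.

End RadiusEquation.

Section RDag.
Context {R : realType} (c : constants R).
Implicit Types M V x y : R.

Lemma sigma_ratio_gt0 : 0 < sigma_ratio c.
Proof. by rewrite divr_gt0 ?sigma_gt0 ?sigma_bar_gt0. Qed.

Lemma I_massE M :
  I_mass c M = 3 * gas_const c * T_c c / (8 * pi * sigma c) * M.
Proof. by rewrite /I_mass; ring. Qed.

Lemma I_mass_coef_gt0 : 0 < 3 * gas_const c * T_c c / (8 * pi * sigma c).
Proof.
by rewrite divr_gt0 ?mulr_gt0 ?pi_gt0 ?gas_const_gt0 ?T_c_gt0 ?sigma_gt0.
Qed.

Lemma I_mass_gt0 M : 0 < M -> 0 < I_mass c M.
Proof. by move=> M0; rewrite I_massE mulr_gt0 ?I_mass_coef_gt0. Qed.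

Lemma V_bar_gt0 V : 0 < V -> 0 < V_bar V.
Proof. by move=> V0; rewrite divr_gt0 ?mulr_gt0 ?pi_gt0. Qed.

Lemma outer_radius_cubed V x : 0 < V -> 0 < x ->
  outer_radius V x ^+ 3 = x ^+ 3 + V_bar V.
Proof.
move=> V0 x0; have h : 0 <= x ^+ 3 + V_bar V.
  by rewrite addr_ge0// ltW ?exprn_gt0 ?V_bar_gt0.
by rewrite /outer_radius -powR_mulrn ?powR_ge0// -powRrM mulVf// powRr1.
Qed.

Lemma outer_radius_gt0 V x : 0 < V -> 0 < x -> 0 < outer_radius V x.
Proof. by move=> V0 x0; rewrite powR_gt0// addr_gt0 ?exprn_gt0 ?V_bar_gt0. Qed.

Lemma outer_radius_gt V x : 0 < V -> 0 < x -> x < outer_radius V x.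
Proof.
move=> V0 x0; rewrite -(@ltr_pXn2r _ 3) ?nnegrE//.
- by rewrite outer_radius_cubed// ltrDl V_bar_gt0.
- exact: ltW.
- by rewrite ltW// outer_radius_gt0.
Qed.

Section Existence.
Variables (M V : R).
Hypotheses (M0 : 0 < M) (V0 : 0 < V).
Let s := sigma_ratio c.
Let I := I_mass c M.
Let b := V_bar V.
Let s0 : 0 < s. Proof. exact: sigma_ratio_gt0. Qed.
Let I0 : 0 < I. Proof. exact: I_mass_gt0. Qed.
Let b0 : 0 < b. Proof. exact: V_bar_gt0. Qed.

Let lo := Num.sqrt I / Num.sqrt (1 + s).
Let hi := Num.sqrt I.

Let lo_gt0 : 0 < lo.
Proof. by rewrite divr_gt0 ?sqrtr_gt0 ?addr_gt0. Qed.

Let hi_gt0 : 0 < hi. Proof. by rewrite sqrtr_gt0. Qed.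

Let Q_lo : radius_fun s I b lo < 0.
Proof.
apply: radius_fun_lower => //; rewrite expr_div_n !sqr_sqrtr ?(ltW I0)//.
  by rewrite divfK// gt_eqF// addr_gt0.
by rewrite ltW// addr_gt0.
Qed.

Let Q_hi : 0 < radius_fun s I b hi.
Proof. by apply: radius_fun_gt0 => //; rewrite sqr_sqrtr// ltW. Qed.

Let lo_lt_hi : lo < hi.
Proof.
rewrite ltr_pdivrMr ?sqrtr_gt0 ?addr_gt0// -[ltLHS]mulr1 ltr_pM2l//.
by rewrite -{1}sqrtr1 ltr_sqrt ?ltrDl// addr_gt0.
Qed.

Lemma radius_poly_root_unique : exists! x, 0 < x /\ root (radius_poly c M V) x.
Proof.
have [|x] := @poly_ivt _ (radius_poly c M V) _ _ (ltW lo_lt_hi).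
  by rewrite !radius_polyE !ltW.
move=> /andP[lox xhi] rx; have x0 := lt_le_trans lo_gt0 lox.
exists x; split => // y [y0]; move: rx; rewrite /root !radius_polyE.
move=> /eqP Qx /eqP Qy; apply/eqP; have [xy|yx|//] := ltgtP x y.
  by have := radius_fun_sign_incr s0 I0 b0 x0 xy; rewrite Qx Qy ltxx => ->.
by have := radius_fun_sign_incr s0 I0 b0 y0 yx; rewrite Qx Qy ltxx => ->.
Qed.

Lemma R_dag_root : 0 < R_dag c M V /\ root (radius_poly c M V) (R_dag c M V).
Proof.
have [x [rx _]] := radius_poly_root_unique.
rewrite /R_dag.
exact: (@xgetPex _ 0 [set x | 0 < x /\ root (radius_poly c M V) x] (ex_intro _ x rx)).
Qed.

Lemma R_dag_gt0 : 0 < R_dag c M V. Proof. by case: R_dag_root. Qed.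

Lemma radius_fun_R_dag : radius_fun s I b (R_dag c M V) = 0.
Proof. by case: R_dag_root => _ /rootP; rewrite radius_polyE. Qed.

Lemma R_dag_unique x : 0 < x -> radius_fun s I b x = 0 -> R_dag c M V = x.
Proof.
move=> x0 Qx; have [y [_ yu]] := radius_poly_root_unique.
rewrite -(yu _ R_dag_root); apply: yu; split => //.
by rewrite /root radius_polyE -/s -/I -/b Qx.
Qed.

Lemma radius_fun_lt0 x : 0 < x -> (radius_fun s I b x < 0) = (x < R_dag c M V).
Proof.
move=> x0; apply/idP/idP => [Qx|xR].
  rewrite ltNge; apply/negP => Rx.
  have [e|ne] := eqVneq x (R_dag c M V).
    by move: Qx; rewrite e radius_fun_R_dag ltxx.
  have Rx' : R_dag c M V < x by rewrite lt_neqAle eq_sym ne.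
  have := radius_fun_sign_incr s0 I0 b0 R_dag_gt0 Rx'.
  by rewrite radius_fun_R_dag lexx ltNge (ltW Qx) => /(_ isT).
rewrite ltNge; apply/negP => Qx.
have := radius_fun_sign_incr s0 I0 b0 x0 xR Qx.
by rewrite radius_fun_R_dag ltxx.
Qed.

Lemma radius_fun_pos x : 0 < x -> (0 < radius_fun s I b x) = (R_dag c M V < x).
Proof.
move=> x0; rewrite [RHS]ltNge le_eqVlt -radius_fun_lt0// negb_or -leNgt.
rewrite lt_neqAle eq_sym; congr (~~ _ && _).
by apply/eqP/eqP => [Qx|->]; [rewrite (R_dag_unique x0 Qx)|
  rewrite radius_fun_R_dag].
Qed.

Lemma R_dag_bounds :
  Num.sqrt (3 * gas_const c * T_c c * M / (8 * pi * sigma c))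
    / Num.sqrt (1 + sigma_bar c / sigma c) < R_dag c M V
  < Num.sqrt (3 * gas_const c * T_c c * M / (8 * pi * sigma c)).
Proof. by rewrite -/(I_mass c M) -radius_fun_lt0// -radius_fun_pos// Q_lo Q_hi. Qed.

End Existence.

(** Multiplied by [2 sigma / (x ^ 3 y)], the equation of [radius_fun_root_eq] becomes the
    force balance [p_g = 2 sigma / x + 2 sigma_bar / y] of an equilibrium of gas radius [x]
    and outer radius [y]. *)
Lemma radius_fun_pressure M V x q : 0 < V -> 0 < x ->
  M = 4 * pi / 3 * x ^+ 3 * q ->
  radius_fun (sigma_ratio c) (I_mass c M) (V_bar V) x = 0 <->
  q = 2 / (gas_const c * T_c c) *
      (sigma c / x + sigma_bar c / outer_radius V x).
Proof.
move=> V0 x0 ->; set y := outer_radius V x.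
have y0 : 0 < y by apply: outer_radius_gt0.
rewrite (radius_fun_root_eq _ sigma_ratio_gt0 x0 y0); last first.
  by rewrite outer_radius_cubed.
rewrite /sigma_ratio /I_mass.
move: y y0 (pi_gt0 R) (sigma_gt0 c) (gas_const_gt0 c) (T_c_gt0 c).
move: pi (sigma c) (sigma_bar c) (gas_const c) (T_c c) => p s sb g T y y0 p0 s0 g0 T0.
split=> [h|->]; last by field; rewrite !gt_eqF.
have -> : q = (3 * g * T * (4 * p / 3 * x ^+ 3 * q) / (8 * p * s)) * (2 * s)
    / (x ^+ 3 * g * T) by field; rewrite !gt_eqF.
set I := 3 * g * T * (4 * p / 3 * x ^+ 3 * q) / (8 * p * s) in h *.
have -> : I = sb / s * x ^+ 3 / y + x ^+ 2 by rewrite h; field; rewrite gt_eqF.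
by field; rewrite !gt_eqF.
Qed.

Lemma rho_dag_mass M V : 0 < M -> 0 < V ->
  M = 4 * pi / 3 * R_dag c M V ^+ 3 * rho_dag c M V.
Proof.
move=> M0 V0; rewrite /rho_dag; move: (R_dag_gt0 M0 V0) (pi_gt0 R).
by move: pi (R_dag c M V) => p x x0 p0; field; rewrite !gt_eqF.
Qed.

Lemma rho_dag_pressure M V : 0 < M -> 0 < V ->
  rho_dag c M V = 2 / (gas_const c * T_c c) *
    (sigma c / R_dag c M V + sigma_bar c / outer_radius V (R_dag c M V)).
Proof.
move=> M0 V0; apply/(radius_fun_pressure V0 (R_dag_gt0 M0 V0) (rho_dag_mass M0 V0)).
exact: radius_fun_R_dag.
Qed.

(** The root equation is linear in [V_bar], with nonzero coefficient because
    [R_dag ^ 2 < I], so the radius determines the volume once the mass is known. *)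
Lemma dag_map_inj M V M' V' : 0 < M -> 0 < V -> 0 < M' -> 0 < V' ->
  dag_map c (M, V) = dag_map c (M', V') -> (M, V) = (M', V').
Proof.
move=> M0 V0 M'0 V'0 [/= eR er].
have eM : M = M'.
  by rewrite (rho_dag_mass M0 V0) (rho_dag_mass M'0 V'0) eR er.
rewrite -eM in M'0 eR *; congr pair.
have x0 := R_dag_gt0 M0 V0.
have := radius_fun_R_dag M0 V0; have := radius_fun_R_dag M0 V'0.
rewrite -eR /radius_fun => e1 e2.
have Ix : R_dag c M V ^+ 2 - I_mass c M != 0.
  rewrite subr_eq0; apply/eqP => e.
  have := @radius_fun_gt0 _ _ (I_mass c M) _ _ sigma_ratio_gt0 (V_bar_gt0 V0) x0.
  by rewrite radius_fun_R_dag// e lexx ltxx => /(_ isT).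
have : V_bar V = V_bar V'.
  apply: (@mulIf _ ((R_dag c M V ^+ 2 - I_mass c M) ^+ 3)); first exact: expf_neq0.
  lra.
rewrite /V_bar => /(congr1 ( *%R^~ (4 * pi))).
rewrite !divfK; last 2 first.
  by rewrite mulf_neq0// gt_eqF// pi_gt0.
  by rewrite mulf_neq0// gt_eqF// pi_gt0.
by move=> e; lra.
Qed.

End RDag.

(** * Calculus of [C^n] functions *)

Lemma line_cvg {R : realType} {V : normedModType R} (x v : V) :
  h *: v + x @[h --> (0 : R)^'] --> x.
Proof.
rewrite -[X in _ --> X]add0r; apply: cvgD; last exact: cvg_cst.
rewrite -[X in _ --> X](scale0r v); apply: cvgZl.
exact: nbhs_dnbhs.
Qed.

Lemma cvg_is_derive {R : realType} {V W : normedModType R} (f : V -> W) x v l :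
  h^-1 *: (f (h *: v + x) - f x) @[h --> 0^'] --> l -> is_derive x v f l.
Proof.
by move=> fl; split; [apply/cvg_ex; exists l; exact: fl|exact: cvg_lim fl].
Qed.

Section CnCalculus.
Context {R : realType} {V : normedModType R}.
Variable U : set V.
Hypothesis oU : open U.

Lemma Cn_on_continuous {W : normedModType R} n (f : V -> W) x :
  Cn_on n U f -> U x -> {for x, continuous f}.
Proof. by case: n => [|n] [h _]; exact: h. Qed.

Lemma Cn_on_ext {W : normedModType R} n (f g : V -> W) :
  (forall x, U x -> f x = g x) -> Cn_on n U f -> Cn_on n U g.
Proof.
have nearfg (f' g' : V -> W) x : (forall x, U x -> f' x = g' x) -> U x ->
    \near x, f' x = g' x.
  by move=> fg Ux; apply: filterS fg _; exact: open_nbhs_nbhs.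
have cfg f' g' : (forall x, U x -> f' x = g' x) ->
    (forall x, U x -> {for x, continuous f'}) ->
    forall x, U x -> {for x, continuous (g' : V -> W)}.
  move=> fg cf x Ux; have := cf x Ux; rewrite /prop_for /continuous_at (fg x Ux).
  by apply: cvg_trans; apply: near_eq_cvg; exact: nearfg.
elim: n f g => [|n IH] f g fg [cf df]; split => //.
- exact: cfg cf.
- exact: cfg cf.
- move=> v; have [dfv cdf] := df v; split.
    by move=> x Ux; apply: near_eq_derivable (dfv x Ux); exact: nearfg.
  apply: IH cdf => x Ux; apply: near_eq_derive; exact: nearfg.
Qed.

(** The introduction rule for [Cn_on]: the derivatives only have to be known on [U], as
    [U] is open. *)
Lemma Cn_onS {W : normedModType R} n (f : V -> W) :
  (forall x, U x -> {for x, continuous f}) ->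
  (forall v, exists2 g, Cn_on n U g & forall x, U x -> is_derive x v f (g x)) ->
  Cn_on n.+1 U f.
Proof.
move=> cf df; split => // v; have [g cg fg] := df v; split.
  by move=> x /fg[].
by apply: Cn_on_ext cg => x /fg fgx; rewrite derive_val.
Qed.

Lemma Cn_on_is_derive {W : normedModType R} n (f : V -> W) x v :
  Cn_on n.+1 U f -> U x -> is_derive x v f ('D_v f x).
Proof. by move=> [_ /(_ v)[df _]] /df /derivableP. Qed.

Lemma Cn_on_derive {W : normedModType R} n (f : V -> W) v :
  Cn_on n.+1 U f -> Cn_on n U ('D_v f).
Proof. by move=> [_ /(_ v)[]]. Qed.

Lemma Cn_on_pred {W : normedModType R} n (f : V -> W) : Cn_on n.+1 U f -> Cn_on n U f.
Proof.
elim: n f => [|n IH] f [cf df]; split => // v.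
by have [? /IH] := df v.
Qed.

Lemma Cn_on_cst {W : normedModType R} n (a : W) : Cn_on n U (cst a).
Proof.
elim: n a => [|n IH] a; first by split => // x _; exact: cst_continuous.
apply: Cn_onS => [x _|v]; first exact: cst_continuous.
by exists (cst 0) => // x _; exact: is_derive_cst.
Qed.

Lemma Cn_onD n (f g : V -> R) :
  Cn_on n U f -> Cn_on n U g -> Cn_on n U (fun x => f x + g x).
Proof.
elim: n f g => [|n IH] f g cf cg.
  split=> // x Ux.
  by apply: continuousD; [exact: (Cn_on_continuous cf)|exact: (Cn_on_continuous cg)].
apply: Cn_onS => [x Ux|v].
  by apply: continuousD; [exact: (Cn_on_continuous cf)|exact: (Cn_on_continuous cg)].
exists (fun x => 'D_v f x + 'D_v g x).
  by apply: IH; exact: Cn_on_derive.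
by move=> x Ux; apply: is_deriveD; [exact: (Cn_on_is_derive _ cf)|exact: (Cn_on_is_derive _ cg)].
Qed.

Lemma Cn_onM n (f g : V -> R) :
  Cn_on n U f -> Cn_on n U g -> Cn_on n U (fun x => f x * g x).
Proof.
elim: n f g => [|n IH] f g cf cg.
  split=> // x Ux.
  by apply: continuousM; [exact: (Cn_on_continuous cf)|exact: (Cn_on_continuous cg)].
apply: Cn_onS => [x Ux|v].
  by apply: continuousM; [exact: (Cn_on_continuous cf)|exact: (Cn_on_continuous cg)].
exists (fun x => f x * 'D_v g x + g x * 'D_v f x).
  by apply: Cn_onD; apply: IH; do ?[exact: Cn_on_derive|exact: Cn_on_pred].
by move=> x Ux; apply: is_deriveM; [exact: (Cn_on_is_derive _ cf)|exact: (Cn_on_is_derive _ cg)].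
Qed.

Lemma Cn_onV n (f : V -> R) : (forall x, U x -> f x != 0) ->
  Cn_on n U f -> Cn_on n U (fun x => (f x)^-1).
Proof.
move=> f0; elim: n => [|n IH] cf.
  split=> // x Ux; apply: continuousV; first exact: f0.
  exact: (Cn_on_continuous cf).
apply: Cn_onS => [x Ux|v].
  by apply: continuousV; [exact: f0|exact: (Cn_on_continuous cf)].
have cV := IH (Cn_on_pred cf).
exists (fun x => cst (-1) x * ((f x)^-1 * ((f x)^-1 * 'D_v f x))).
  apply: Cn_onM (Cn_on_cst _ _) _; do 2?[apply: Cn_onM => //].
  exact: Cn_on_derive.
move=> x Ux; have [dfx _] := Cn_on_is_derive v cf Ux.
apply: DeriveDef; first exact: derivableV (f0 x Ux) dfx.
rewrite deriveV ?f0// /cst /= expr2 invfM.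
by change (_ *: _) with (- ((f x)^-1 * (f x)^-1) * 'D_v f x); ring.
Qed.

Lemma Cn_onX n k (f : V -> R) : Cn_on n U f -> Cn_on n U (fun x => f x ^+ k).
Proof.
move=> cf; elim: k => [|k IH]; first exact: Cn_on_cst.
by under [X in Cn_on _ _ X]eq_fun do rewrite exprS; exact: Cn_onM.
Qed.

Lemma Cn_on_pair {W W' : normedModType R} n (f : V -> W) (g : V -> W') :
  Cn_on n U f -> Cn_on n U g -> Cn_on n U (fun x => (f x, g x)).
Proof.
elim: n f g => [|n IH] f g cf cg.
  split=> // x Ux.
  by apply: cvg_pair; [exact: (Cn_on_continuous cf)|exact: (Cn_on_continuous cg)].
apply: Cn_onS => [x Ux|v].
  by apply: cvg_pair; [exact: (Cn_on_continuous cf)|exact: (Cn_on_continuous cg)].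
exists (fun x => ('D_v f x, 'D_v g x)); first by apply: IH; exact: Cn_on_derive.
move=> x Ux; have [df _] := Cn_on_is_derive v cf Ux.
have [dg _] := Cn_on_is_derive v cg Ux.
by apply: cvg_is_derive; exact: (cvg_pair df dg).
Qed.

End CnCalculus.

(** Follows the syntax of a polynomial expression.  Matching on the head operation is
    essential: left to unification, the rules would unfold the field operations. *)
Ltac Cn_on_rational := cbv zeta; repeat lazymatch goal with
  | |- open _ => assumption
  | |- Cn_on _ _ (fun _ => ?a) => exact: Cn_on_cst
  | |- Cn_on _ _ (fun p => @?f p + @?g p) => apply: (Cn_onD _ (f := f) (g := g))
  | |- Cn_on _ _ (fun p => @?f p * @?g p) => apply: (Cn_onM _ (f := f) (g := g))
  | |- Cn_on _ _ (fun p => @?f p ^+ ?k) => apply: (Cn_onX _ k (f := f))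
  | |- Cn_on _ _ _ => assumption
  end.

(** * Smooth dependence of the equilibrium on mass and volume *)

Section DagSmooth.
Context {R : realType} (c : constants R).
Local Notation U := (@quadrant R).
Local Notation s := (sigma_ratio c).
Local Notation k := (3 * gas_const c * T_c c / (8 * pi * sigma c)).
Local Notation l := (3 / (4 * pi) : R).

Definition dag_radius (p : R * R) : R := R_dag c p.1 p.2.
Definition dag_outer (p : R * R) : R := outer_radius p.2 (dag_radius p).

Lemma quadrant_open : open U.
Proof.
rewrite (_ : U = (fst @^-1` [set x | 0 < x]) `&` (snd @^-1` [set x | 0 < x])).
  apply: openI; apply: open_comp; try exact: open_gt.
    by move=> x _; exact: cvg_fst.
  by move=> x _; exact: cvg_snd.
by [].
Qed.

Lemma dag_radius_gt0 p : U p -> 0 < dag_radius p.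
Proof. by case: p => M V [/= M0 V0]; exact: R_dag_gt0. Qed.

Lemma dag_outer_gt p : U p -> dag_radius p < dag_outer p.
Proof. by move=> Up; apply: outer_radius_gt; [case: Up|exact: dag_radius_gt0]. Qed.

Lemma dag_outer_gt0 p : U p -> 0 < dag_outer p.
Proof. by move=> Up; exact: lt_trans (dag_radius_gt0 Up) (dag_outer_gt Up). Qed.

Lemma dag_outerX3 p : U p -> dag_outer p ^+ 3 = dag_radius p ^+ 3 + l * p.2.
Proof.
move=> Up; rewrite outer_radius_cubed ?dag_radius_gt0//; last by case: Up.
by rewrite /V_bar mulrAC.
Qed.

Lemma dag_balance p : U p ->
  s * dag_radius p ^+ 3 = dag_outer p * (k * p.1 - dag_radius p ^+ 2).
Proof.
move=> Up; have [M0 V0] := Up; rewrite -I_massE.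
apply/(@radius_fun_root_eq _ _ _ (V_bar p.2)); last exact: radius_fun_R_dag.
- exact: sigma_ratio_gt0.
- exact: dag_radius_gt0.
- exact: dag_outer_gt0.
- by rewrite outer_radius_cubed// dag_radius_gt0.
Qed.

Lemma radius_fun_continuous x :
  continuous (fun p : R * R => radius_fun s (I_mass c p.1) (V_bar p.2) x).
Proof.
have cI : continuous (fun p : R * R => x ^+ 2 - I_mass c p.1).
  move=> p; apply: cvgB; first exact: cvg_cst.
  under eq_fun do rewrite I_massE.
  by rewrite I_massE; apply: cvgM; [exact: cvg_cst|exact: cvg_fst].
have cV : continuous (fun p : R * R => x ^+ 3 + V_bar p.2).
  move=> p; apply: cvgD; first exact: cvg_cst.
  by apply: cvgM; [apply: cvgM; [exact: cvg_cst|exact: cvg_snd]|exact: cvg_cst].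
move=> p; apply: cvgD; first exact: cvg_cst.
apply: cvgM; first exact: cV.
apply: (@cvg_comp _ _ _ _ (fun y : R => y ^+ 3) _ _ _ (cI p)).
exact: exprn_continuous.
Qed.

(** Since [radius_fun] is negative just below its root and positive just above, and these
    two signs persist when [M] and [V] are perturbed, so does the position of the root. *)
Lemma dag_radius_continuous p : U p -> {for p, continuous dag_radius}.
Proof.
move=> Up; have [M0 V0] := Up; have x0 := dag_radius_gt0 Up.
apply/cvgrPdist_lt => e e0.
have xe0 : 0 < dag_radius p + e by rewrite addr_gt0.
have nU : \forall q \near p, U q by apply: open_nbhs_nbhs; split=> //; exact: quadrant_open.
have n1 : \forall q \near p,
    0 < radius_fun s (I_mass c q.1) (V_bar q.2) (dag_radius p + e).
  apply: (@radius_fun_continuous (dag_radius p + e) p [set y | 0 < y]).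
  apply: open_nbhs_nbhs; split; first exact: open_gt.
  by rewrite /= radius_fun_pos// ltrDl.
have n2 : \forall q \near p, 0 < dag_radius p - e ->
    radius_fun s (I_mass c q.1) (V_bar q.2) (dag_radius p - e) < 0.
  have [xe|xe] := ltP 0 (dag_radius p - e); last by near=> q.
  have h : \forall q \near p,
    radius_fun s (I_mass c q.1) (V_bar q.2) (dag_radius p - e) < 0.
    apply: (@radius_fun_continuous (dag_radius p - e) p [set y | y < 0]).
    apply: open_nbhs_nbhs; split; first exact: open_lt.
    by rewrite /= radius_fun_lt0// gtrBl.
  by apply: filterS h.
near=> q.
have Uq : U q by near: q.
have [Mq Vq] := Uq.
have q1 : dag_radius q < dag_radius p + e.
  by rewrite -radius_fun_pos//; near: q.
have q2 : dag_radius p - e < dag_radius q.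
  have [xe|xe] := ltP 0 (dag_radius p - e); last by apply: le_lt_trans xe _; exact: dag_radius_gt0.
  by rewrite -radius_fun_lt0//; move: (xe); near: q.
by rewrite distrC ltr_distl q1 q2.
Unshelve. all: by end_near. Qed.

Lemma dag_outer_continuous p : U p -> {for p, continuous dag_outer}.
Proof.
move=> Up; rewrite /prop_for /continuous_at.
have cz : (fun q : R * R => dag_radius q ^+ 3 + V_bar q.2) @ p --> dag_radius p ^+ 3 + V_bar p.2.
  apply: cvgD.
    apply: (@cvg_comp _ _ _ _ (fun y : R => y ^+ 3) _ _ _ (dag_radius_continuous Up)).
    exact: exprn_continuous.
  by apply: cvgM; [apply: cvgM; [exact: cvg_cst|exact: cvg_snd]|exact: cvg_cst].
apply: (@cvg_comp _ _ _ _ (fun y : R => y `^ 3^-1) _ _ _ cz).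
suff : {for dag_radius p ^+ 3 + V_bar p.2, continuous (fun y : R => y `^ 3^-1)} by [].
apply: differentiable_continuous; apply/derivable1_diffP.
apply: derivable_powR; rewrite in_itv/= andbT.
by rewrite addr_gt0 ?exprn_gt0 ?dag_radius_gt0 ?V_bar_gt0//; case: Up.
Qed.

(** The coefficient of the unknown increment of [dag_radius] in the linearization of the
    system [s x ^ 3 = y (I - x ^ 2)], [y ^ 3 = x ^ 3 + V_bar], once that of [y] is
    eliminated. *)
Definition dag_radius_slope p : R :=
  let x := dag_radius p in let y := dag_outer p in
  3 * s * x ^+ 2 + 2 * x * y + - s * x ^+ 5 * y^-1 ^+ 3.
Definition dag_radius_derive (v p : R * R) : R :=
  let x := dag_radius p in let y := dag_outer p in
  (k * v.1 * y + s * l / 3 * v.2 * x ^+ 3 * y^-1 ^+ 3) / dag_radius_slope p.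
Definition dag_outer_derive (v p : R * R) : R :=
  (3 * dag_radius p ^+ 2 * dag_radius_derive v p + l * v.2) / 3 * (dag_outer p)^-1 ^+ 2.

(** The negative term is dominated by [3 s x ^ 2] because [x < y]. *)
Lemma dag_radius_slope_gt0 p : U p -> 0 < dag_radius_slope p.
Proof.
move=> Up; have x0 := dag_radius_gt0 Up; have xy := dag_outer_gt Up.
have y0 := dag_outer_gt0 Up.
rewrite /dag_radius_slope; set x := dag_radius p in x0 xy *.
set y := dag_outer p in xy y0 *.
move: (sigma_ratio c) (sigma_ratio_gt0 c) => r r0.
have -> : 3 * r * x ^+ 2 + 2 * x * y + - r * x ^+ 5 * y^-1 ^+ 3 =
  r * x ^+ 2 * (1 - (x / y) ^+ 3) + (2 * r * x ^+ 2 + 2 * x * y).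
  by rewrite expr_div_n exprVn; ring.
apply: ltr_wpDl; last by rewrite addr_gt0 ?mulr_gt0.
rewrite mulr_ge0 ?mulr_ge0 ?exprn_ge0 ?(ltW r0) ?(ltW x0)// subr_ge0.
by rewrite exprn_ile1 ?divr_ge0 ?(ltW x0) ?(ltW y0)// ler_pdivrMr// mul1r ltW.
Qed.

(** Subtracting the system [s x ^ 3 = y (I - x ^ 2)], [y ^ 3 = x ^ 3 + V_bar] at two nearby
    points and factoring the differences of cubes and squares gives equations that are linear
    in the increments, with coefficients [A], [N] below that are continuous; dividing by [h]
    and passing to the limit yields the derivatives. *)
Lemma is_derive_dag p v : U p ->
  is_derive p v dag_radius (dag_radius_derive v p) /\
  is_derive p v dag_outer (dag_outer_derive v p).
Proof.
move=> Up; have x0 := dag_radius_gt0 Up; have y0 := dag_outer_gt0 Up.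
have slope0 := dag_radius_slope_gt0 Up.
set x := dag_radius p in x0 *; set y := dag_outer p in y0 *.
pose q (a b : R) := a ^+ 2 + a * b + b ^+ 2.
pose X h := dag_radius (h *: v + p); pose Y h := dag_outer (h *: v + p).
have shift_cvg := @line_cvg _ _ p v.
have Xx : X h @[h --> 0^'] --> x.
  exact: cvg_comp shift_cvg (dag_radius_continuous Up).
have Yy : Y h @[h --> 0^'] --> y.
  exact: cvg_comp shift_cvg (dag_outer_continuous Up).
have nU : \forall h \near 0^', U (h *: v + p).
  by apply: (shift_cvg U); apply: open_nbhs_nbhs; split=> //; exact: quadrant_open.
pose J := k * p.1 - x ^+ 2.
pose A h := s * q (X h) x + Y h * (X h + x) - J * q (X h) x * (q (Y h) y)^-1.
pose N h := Y h * (k * v.1) + J * (l * v.2) * (q (Y h) y)^-1.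
have qXx : q (X h) x @[h --> 0^'] --> q x x.
  by apply: cvgD; [apply: cvgD; apply: cvgM|]; do ?[exact: cvg_cst|exact: Xx].
have qYy : q (Y h) y @[h --> 0^'] --> q y y.
  by apply: cvgD; [apply: cvgD; apply: cvgM|]; do ?[exact: cvg_cst|exact: Yy].
have qyy0 : q y y != 0 by rewrite gt_eqF// !addr_gt0 ?mulr_gt0.
have JE : J = s * x ^+ 3 / y.
  by rewrite (dag_balance Up) -/x -/y mulrAC divff ?mul1r// gt_eqF.
have cA : A h @[h --> 0^'] --> dag_radius_slope p.
  have -> : dag_radius_slope p = s * q x x + y * (x + x) - J * q x x * (q y y)^-1.
    rewrite JE /dag_radius_slope /q -/x -/y; field.
    by rewrite (gt_eqF y0) andbT; exact: qyy0.
  apply: cvgB; first apply: cvgD.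
  - by apply: cvgM; [exact: cvg_cst|exact: qXx].
  - by apply: cvgM; [exact: Yy|apply: cvgD; [exact: Xx|exact: cvg_cst]].
  - apply: cvgM; last exact: cvgV.
    by apply: cvgM; [exact: cvg_cst|exact: qXx].
have cN : N h @[h --> 0^'] --> y * (k * v.1) + J * (l * v.2) * (q y y)^-1.
  apply: cvgD; first by apply: cvgM; [exact: Yy|exact: cvg_cst].
  by apply: cvgM; [exact: cvg_cst|exact: cvgV].
have nA : \forall h \near 0^', 0 < A h.
  by apply: (cA [set z | 0 < z]); apply: open_nbhs_nbhs; split=> //; exact: open_gt.
have nh : \forall h \near (0 : R)^', h != 0 by exact: nbhs_dnbhs_neq.
have key h : U (h *: v + p) ->
    (X h - x) * A h = h * N h /\
    (Y h - y) * q (Y h) y = (X h - x) * q (X h) x + h * (l * v.2).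
  move=> Uh; have := dag_balance Uh; have := dag_balance Up.
  have := dag_outerX3 Uh; have := dag_outerX3 Up.
  have : q (Y h) y != 0.
    by rewrite gt_eqF// !addr_gt0 ?mulr_gt0 ?exprn_gt0// dag_outer_gt0.
  rewrite -/x -/y -/(X h) -/(Y h).
  have -> : (h *: v + p).1 = h * v.1 + p.1 by [].
  have -> : (h *: v + p).2 = h * v.2 + p.2 by [].
  rewrite /A /N /q /J; move: (X h) (Y h) => X' Y'.
  move: (k) (l) (s) => k' l' s' Q0 e4 e3 e1 e2.
  have E2 : (Y' - y) * (Y' ^+ 2 + Y' * y + y ^+ 2) =
     (X' - x) * (X' ^+ 2 + X' * x + x ^+ 2) + h * (l' * v.2) by lra.
  split=> //.
  have E3 : Y' - y = ((X' - x) * (X' ^+ 2 + X' * x + x ^+ 2) + h * (l' * v.2)) *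
      (Y' ^+ 2 + Y' * y + y ^+ 2)^-1 by rewrite -E2 mulfK.
  have := congr1 ( *%R (k' * p.1 - x ^+ 2)) E3.
  move: (_^-1) => Q; lra.
have quoX : h^-1 *: (X h - x) @[h --> 0^'] --> dag_radius_derive v p.
  have -> : dag_radius_derive v p =
      (y * (k * v.1) + J * (l * v.2) * (q y y)^-1) * (dag_radius_slope p)^-1.
    rewrite /dag_radius_derive; congr (_ / _); rewrite JE /q -/x -/y.
    move: (k) (l) => k' l'; field.
    by rewrite (gt_eqF y0) andbT; exact: qyy0.
  have : N h * (A h)^-1 @[h --> 0^'] -->
    (y * (k * v.1) + J * (l * v.2) * (q y y)^-1) * (dag_radius_slope p)^-1.
    by apply: cvgM => //; apply: cvgV => //; rewrite gt_eqF.
  apply: cvg_trans; apply: near_eq_cvg; near=> h.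
  have Uh : U (h *: v + p) by near: h.
  have [eX _] := key h Uh.
  have h0 : h != 0 by near: h.
  have A0 : A h != 0 by rewrite gt_eqF//; near: h.
  apply: (mulIf A0); rewrite divfK// -[_ *: _]/(_ * _) -mulrA eX.
  by rewrite mulKf.
split; apply: cvg_is_derive => //.
have -> : dag_outer_derive v p =
    (dag_radius_derive v p * q x x + l * v.2) * (q y y)^-1.
  rewrite /dag_outer_derive /q -/x -/y; move: (l) => l'; field.
  by rewrite (gt_eqF y0) andbT; exact: qyy0.
have : ((h^-1 *: (X h - x)) * q (X h) x + l * v.2) * (q (Y h) y)^-1
    @[h --> 0^'] --> (dag_radius_derive v p * q x x + l * v.2) * (q y y)^-1.
  apply: cvgM; last exact: cvgV.
  by apply: cvgD; [exact: cvgM|exact: cvg_cst].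
apply: cvg_trans; apply: near_eq_cvg; near=> h.
have Uh : U (h *: v + p) by near: h.
have [_ eY] := key h Uh.
have h0 : h != 0 by near: h.
have Q0 : q (Y h) y != 0.
  by rewrite gt_eqF// !addr_gt0 ?mulr_gt0 ?exprn_gt0// dag_outer_gt0.
apply: (mulIf Q0); rewrite divfK// -![_ *: _]/(_ * _) -[RHS]mulrA eY.
by rewrite [RHS]mulrDr mulKf// mulrA.
Unshelve. all: by end_near. Qed.

(** The derivatives of [dag_radius] and [dag_outer] are rational in the two functions
    themselves, so [C^n] bootstraps to [C^n.+1]. *)
Lemma Cn_on_dag n : Cn_on n U dag_radius /\ Cn_on n U dag_outer.
Proof.
elim: n => [|n [cx cy]].
  by split; split => // p Up; [exact: dag_radius_continuous|exact: dag_outer_continuous].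
have oU := quadrant_open.
have cyV : Cn_on n U (fun p => (dag_outer p)^-1).
  by apply: Cn_onV => // p Up; rewrite gt_eqF// dag_outer_gt0.
have cslope : Cn_on n U dag_radius_slope by rewrite /dag_radius_slope; Cn_on_rational.
have cslopeV : Cn_on n U (fun p => (dag_radius_slope p)^-1).
  by apply: Cn_onV => // p Up; rewrite gt_eqF// dag_radius_slope_gt0.
have cdx v : Cn_on n U (dag_radius_derive v).
  by rewrite /dag_radius_derive; Cn_on_rational.
have cdy v : Cn_on n U (dag_outer_derive v).
  by rewrite /dag_outer_derive; Cn_on_rational.
split; apply: Cn_onS => //.
- exact: dag_radius_continuous.
- by move=> v; exists (dag_radius_derive v) => // p Up; case: (is_derive_dag v Up).
- exact: dag_outer_continuous.
- by move=> v; exists (dag_outer_derive v) => // p Up; case: (is_derive_dag v Up).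
Qed.

Lemma Cn_on_fst n : Cn_on n U (fst : R * R -> R).
Proof.
have oU := quadrant_open.
case: n => [|n]; first by split; [move=> p _; exact: cvg_fst|].
apply: (Cn_onS oU) => [p _|v]; first exact: cvg_fst.
exists (cst v.1); first exact: Cn_on_cst.
move=> p _; apply: cvg_is_derive.
apply: cvg_trans (cvg_cst _ : cst v.1 @ 0^' --> v.1); apply: near_eq_cvg.
near=> h; rewrite /= addrK -[_ *: _]/(_ * _) mulKf//; near: h.
exact: nbhs_dnbhs_neq.
Unshelve. all: by end_near. Qed.

Lemma dag_map_smooth : smooth_on U (dag_map c).
Proof.
move=> n; have oU := quadrant_open; have [cx _] := Cn_on_dag n.
have cV : Cn_on n U (fun p => (4 * pi * R_dag c p.1 p.2 ^+ 3)^-1).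
  apply: Cn_onV => //; last by Cn_on_rational.
  move=> p Up; have := dag_radius_gt0 Up; rewrite /dag_radius => x0.
  by rewrite gt_eqF// !mulr_gt0 ?exprn_gt0 ?pi_gt0.
have cM := Cn_on_fst n.
by apply: Cn_on_pair => //; rewrite /rho_dag; Cn_on_rational.
Qed.

End DagSmooth.

(** * Euclidean geometry of balls and shells *)

Section Euclid.
Context {R : realType}.
Local Notation E := 'rV[R]_3.
Implicit Types (x y u v : E) (r a b t : R).

Definition basis_vec (i : 'I_3) : E := delta_mx ord0 i.

Lemma dotC u v : dot u v = dot v u.
Proof. by apply: eq_bigr => i _; rewrite mulrC. Qed.

Lemma dotDl u v w : dot (u + v) w = dot u w + dot v w.
Proof. by rewrite -big_split; apply: eq_bigr => i _; rewrite mxE mulrDl. Qed.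

Lemma dotZl a u v : dot (a *: u) v = a * dot u v.
Proof. by rewrite mulr_sumr; apply: eq_bigr => i _; rewrite mxE mulrA. Qed.

Lemma dotDr u v w : dot u (v + w) = dot u v + dot u w.
Proof. by rewrite dotC dotDl !(dotC u). Qed.

Lemma dotZr a u v : dot u (a *: v) = a * dot u v.
Proof. by rewrite dotC dotZl dotC. Qed.

Lemma dotNl u v : dot (- u) v = - dot u v.
Proof. by rewrite -scaleN1r dotZl mulN1r. Qed.

Lemma dotNr u v : dot u (- v) = - dot u v.
Proof. by rewrite dotC dotNl dotC. Qed.

Lemma dot_basis u i : dot u (basis_vec i) = u ord0 i.
Proof.
rewrite /dot (bigD1 i)//= big1 ?addr0 => [|j ji]; first by rewrite !mxE !eqxx mulr1.
by rewrite !mxE eqxx (negbTE ji) mulr0.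
Qed.

Lemma dot_ge0 u : 0 <= dot u u.
Proof. by apply: sumr_ge0 => i _; rewrite -expr2 sqr_ge0. Qed.

Lemma coord_sqr_le u i : u ord0 i ^+ 2 <= dot u u.
Proof.
rewrite /dot (bigD1 i)//= -expr2 lerDl.
by apply: sumr_ge0 => j _; rewrite -expr2 sqr_ge0.
Qed.

Lemma enorm_ge0 u : 0 <= enorm u. Proof. exact: sqrtr_ge0. Qed.

Lemma enorm_sqr u : enorm u ^+ 2 = dot u u.
Proof. by rewrite sqr_sqrtr// dot_ge0. Qed.

Lemma enorm0 : enorm (0 : E) = 0.
Proof. by rewrite /enorm /dot big1 ?sqrtr0// => i _; rewrite mxE mul0r. Qed.

Lemma coord_le_enorm u i : `|u ord0 i| <= enorm u.
Proof. by rewrite -sqrtr_sqr ler_wsqrtr// coord_sqr_le. Qed.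

Lemma enorm_eq0 u : enorm u = 0 -> u = 0.
Proof.
move=> u0; apply/rowP => i; rewrite mxE; apply/eqP; rewrite -normr_le0 -u0.
exact: coord_le_enorm.
Qed.

Lemma enorm_gt0 u : (0 < enorm u) = (u != 0).
Proof.
rewrite lt0r enorm_ge0 andbT; congr (~~ _).
by apply/eqP/eqP => [/enorm_eq0//|->]; exact: enorm0.
Qed.

Lemma enormZ a u : enorm (a *: u) = `|a| * enorm u.
Proof.
by rewrite /enorm dotZl dotZr mulrA -expr2 sqrtrM ?sqr_ge0// sqrtr_sqr.
Qed.

Lemma enormN u : enorm (- u) = enorm u.
Proof. by rewrite /enorm dotNl dotNr opprK. Qed.

Lemma enorm_basis i : enorm (basis_vec i) = 1.
Proof. by rewrite /enorm dot_basis mxE !eqxx sqrtr1. Qed.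

Lemma dot_le_enorm u v : dot u v <= enorm u * enorm v.
Proof.
have [->|u0] := eqVneq u 0.
  by rewrite enorm0 mul0r /dot big1// => i _; rewrite mxE mul0r.
have [->|v0] := eqVneq v 0.
  by rewrite enorm0 mulr0 dotC /dot big1// => i _; rewrite mxE mul0r.
have := dot_ge0 (enorm v *: u - enorm u *: v).
rewrite !(dotDl, dotDr, dotNl, dotNr, dotZl, dotZr) -!enorm_sqr (dotC v u).
move: u0 v0; rewrite -!enorm_gt0; move: (enorm u) (enorm v) (dot u v) => p q d p0 q0 h.
have : 0 < p * q by rewrite mulr_gt0.
rewrite -subr_ge0 => pq; rewrite -(pmulr_rge0 _ pq); lra.
Qed.

Lemma ler_enormD u v : enorm (u + v) <= enorm u + enorm v.
Proof.
rewrite -(@ler_pXn2r _ 2)// ?nnegrE ?addr_ge0 ?enorm_ge0//.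
rewrite enorm_sqr dotDl !dotDr -!enorm_sqr (dotC v u).
by have := dot_le_enorm u v; lra.
Qed.

Lemma ler_enormB u v : enorm u - enorm v <= enorm (u - v).
Proof. by rewrite lerBlDr -{1}(subrK v u) ler_enormD. Qed.

(** Only the equivalence of the two norms matters; [2] is a round bound for [sqrt 3]. *)
Lemma enorm_le_norm u : enorm u <= 2 * `|u|.
Proof.
rewrite -(@ler_pXn2r _ 2)// ?nnegrE ?mulr_ge0 ?enorm_ge0//.
rewrite enorm_sqr exprMn; apply: (@le_trans _ _ (\sum_(i < 3) `|u| ^+ 2)).
  apply: ler_sum => i _; rewrite -expr2 -(real_normK (num_real (u ord0 i))).
  rewrite ler_pXn2r// ?nnegrE//.
  rewrite {2}/Num.norm/= mx_normrE.
  exact: (le_bigmax _ (fun ij => `|u ij.1 ij.2|) (ord0, i)).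
rewrite sumr_const card_ord.
by have := sqr_ge0 `|u|; rewrite -mulr_natl; lra.
Qed.

Lemma enorm_continuous : continuous (@enorm R).
Proof.
move=> x; apply/(@cvgrPdist_le _ _ _ (nbhs x)) => e e0.
have close : \forall y \near x, `|x - y| <= e / 2.
  by have /cvgrPdist_le := @cvg_id _ (nbhs x); apply; rewrite divr_gt0.
near=> y; have : enorm (x - y) <= e.
  apply: le_trans (enorm_le_norm _) _; rewrite mulrC -ler_pdivlMr//.
  by near: y; exact: close.
apply: le_trans; rewrite ler_norml ler_enormB lerNl opprB andbT.
by rewrite -[X in _ <= X]enormN opprB ler_enormB.
Unshelve. all: by end_near. Qed.

(** Rationalizing the difference quotient removes the square root from the numerator. *)
Lemma is_derive_enorm x v : x != 0 -> is_derive x v (@enorm R) (dot x v / enorm x).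
Proof.
rewrite -enorm_gt0 => x0; apply: cvg_is_derive.
have shift_cvg := @line_cvg _ _ x v.
have cn : enorm (h *: v + x) @[h --> 0^'] --> enorm x.
  exact: cvg_comp shift_cvg (@enorm_continuous x).
have -> : dot x v / enorm x = (2 * dot x v + 0 * dot v v) / (enorm x + enorm x).
  by field; rewrite !gt_eqF ?addr_gt0.
have : (2 * dot x v + h * dot v v) / (enorm (h *: v + x) + enorm x) @[h --> 0^'] -->
    (2 * dot x v + 0 * dot v v) / (enorm x + enorm x).
  apply: cvgM.
    apply: cvgD; first exact: cvg_cst.
    by apply: cvgM; [exact: nbhs_dnbhs|exact: cvg_cst].
  apply: cvgV; first by rewrite gt_eqF// addr_gt0.
  by apply: cvgD => //; exact: cvg_cst.
apply: cvg_trans; apply: near_eq_cvg; near=> h.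
have h0 : h != 0 by near: h; exact: nbhs_dnbhs_neq.
have n0 : enorm (h *: v + x) + enorm x != 0.
  by rewrite gt_eqF// ltr_wpDl ?enorm_ge0.
apply: (mulIf n0); rewrite divfK// -[_ *: _]/(_ * _) -mulrA -subr_sqr !enorm_sqr.
apply: (mulfI h0); rewrite mulVKf//.
by rewrite !(dotDl, dotDr, dotZl, dotZr) (dotC v x); ring.
Unshelve. all: by end_near. Qed.

Lemma eball_open r : open (@eball R r).
Proof. apply: (@open_comp _ _ (@enorm R) [set y | y < r]) => [x _|].
  exact: enorm_continuous.
exact: open_lt. Qed.

Definition shell a b : set E := [set x | a < enorm x < b].

Lemma shell_open a b : open (shell a b).
Proof.
rewrite (_ : shell a b = [set x | a < enorm x] `&` eball b).
  apply: openI; last exact: eball_open.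
  apply: (@open_comp _ _ (@enorm R) [set y | a < y]) => [x _|].
    exact: enorm_continuous.
  exact: open_gt.
by apply/seteqP; split=> x /=; [move/andP|move=> ?; apply/andP].
Qed.

Lemma closed_enorm_le b : closed [set x : E | enorm x <= b].
Proof.
apply: (@preimage_closed _ _ (@enorm R) [set y | y <= b]) => [x _|].
  exact: enorm_continuous.
exact: closed_le.
Qed.

Lemma closed_enorm_ge a : closed [set x : E | a <= enorm x].
Proof.
apply: (@preimage_closed _ _ (@enorm R) [set y | a <= y]) => [x _|].
  exact: enorm_continuous.
exact: closed_ge.
Qed.

Lemma scale_near x (B : set E) : nbhs x B -> \forall t \near (1 : R), B (t *: x).
Proof.
move=> Bx; have : t *: x @[t --> (1 : R)] --> x.
  by rewrite -[X in _ --> X]scale1r; apply: cvgZl; exact: cvg_id.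
exact.
Qed.

Lemma closure_eball r : 0 < r -> closure (@eball R r) = [set x | enorm x <= r].
Proof.
move=> r0; apply/seteqP; split.
  apply: (@subset_trans _ (closure [set x | enorm x <= r])).
    by apply: closureS => x /ltW.
  by rewrite -(closure_id _).1//; exact: closed_enorm_le.
move=> x /= xr B /scale_near Bx; near (at_left (1 : R)) => t.
have t1 : t < 1 by near: t; exact: nbhs_left_lt.
have t0 : 0 < t by near: t; exact: nbhs_left_gt.
exists (t *: x); split; last by near: t; apply: cvg_within; exact: Bx.
rewrite /eball/= enormZ gtr0_norm//.
have := enorm_ge0 x; rewrite le_eqVlt => /orP[/eqP<-|x0]; first by rewrite mulr0.
by apply: lt_le_trans xr; rewrite gtr_pMl.
Unshelve. all: by end_near. Qed.

Lemma closure_shell a b : 0 < a -> a < b ->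
  closure (shell a b) = [set x | a <= enorm x <= b].
Proof.
move=> a0 ab; apply/seteqP; split.
  have -> : [set x : E | a <= enorm x <= b] =
      [set x | a <= enorm x] `&` [set x | enorm x <= b].
    by apply/seteqP; split=> x /=; [move/andP|move=> ?; apply/andP].
  rewrite closureE; apply: smallest_sub.
    by apply: closedI; [exact: closed_enorm_ge|exact: closed_enorm_le].
  by move=> x /andP[/ltW ? /ltW ?]; split.
move=> x /= /andP[ax xb] B /scale_near Bx.
have x0 : 0 < enorm x by exact: lt_le_trans ax.
have [xa|xa] := ltP a (enorm x).
  near (at_left (1 : R)) => t.
  have t1 : t < 1 by near: t; exact: nbhs_left_lt.
  have ta : a / enorm x < t.
    by near: t; apply: nbhs_left_gt; rewrite ltr_pdivrMr// mul1r.
  have t0 : 0 < t by apply: lt_trans ta; rewrite divr_gt0.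
  exists (t *: x); split; last by near: t; apply: cvg_within; exact: Bx.
  rewrite /shell/= enormZ gtr0_norm// -ltr_pdivrMr// ta/=.
  by apply: lt_le_trans xb; rewrite gtr_pMl.
near (at_right (1 : R)) => t.
have t1 : 1 < t by near: t; exact: nbhs_right_gt.
have tb : t < b / enorm x.
  near: t; apply: nbhs_right_lt; rewrite ltr_pdivlMr// mul1r.
  exact: le_lt_trans ab.
have t0 : 0 < t by apply: lt_trans t1.
exists (t *: x); split; last by near: t; apply: cvg_within; exact: Bx.
rewrite /shell/= enormZ gtr0_norm// -ltr_pdivlMr// tb andbT.
by apply: le_lt_trans ax _; rewrite ltr_pMl.
Unshelve. all: by end_near. Qed.

Lemma boundary_eball r : 0 < r -> boundary (@eball R r) = [set x | enorm x = r].
Proof.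
move=> r0; rewrite /boundary closure_eball// (_ : interior _ = eball r); last first.
  by apply/interior_id; exact: eball_open.
apply/seteqP; split=> x /= => [[xr /negP]|xr].
  by rewrite -leNgt => rx; apply/eqP; rewrite eq_le xr.
by rewrite /eball/= xr lexx ltxx; split.
Qed.

Lemma boundary_shell a b : 0 < a -> a < b ->
  boundary (shell a b) = [set x | enorm x = a \/ enorm x = b].
Proof.
move=> a0 ab; rewrite /boundary closure_shell// (_ : interior _ = shell a b); last first.
  by apply/interior_id; exact: shell_open.
apply/seteqP; split=> x /=.
  move=> [/andP[ax xb] nx].
  have [|xa] := eqVneq (enorm x) a; first by left.
  have [|xb'] := eqVneq (enorm x) b; first by right.
  by case: nx; rewrite /shell/= !lt_neqAle ax xb eq_sym xa xb'.
by rewrite /shell/=; move=> [->|->]; rewrite lexx ltxx ?andbF (ltW ab); split.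
Qed.

Lemma eball_inj r r' : 0 < r -> 0 < r' -> @eball R r = eball r' -> r = r'.
Proof.
move=> r0 r'0 e; have : boundary (@eball R r) (r *: basis_vec ord0).
  by rewrite boundary_eball//= enormZ enorm_basis mulr1 gtr0_norm.
by rewrite e boundary_eball//= enormZ enorm_basis mulr1 gtr0_norm.
Qed.

Lemma eball_bounded r : bounded_set (@eball R r).
Proof.
exists r; split; first exact: num_real.
move=> m rm x /= /ltW xr; apply: le_trans (ltW rm).
rewrite /Num.norm/= mx_normrE; apply/bigmax_leP; split.
  by apply: le_trans xr; exact: enorm_ge0.
move=> [i j] _ /=; rewrite (ord1 i).
exact: le_trans (coord_le_enorm _ _) xr.
Qed.

(** ** Signed distance, normal and curvature of a ball *)

Lemma set_distance_ge A x t : A !=set0 -> (forall y, A y -> t <= enorm (x - y)) ->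
  t <= set_distance x A.
Proof.
move=> [z Az] h; apply: lb_le_inf; first by exists (enorm (x - z)), z.
by move=> _ [y Ay <-]; exact: h.
Qed.

Lemma set_distance_le A x y : A y -> set_distance x A <= enorm (x - y).
Proof.
move=> Ay; apply: ge_inf; last by exists y.
by exists 0 => _ [z _ <-]; exact: enorm_ge0.
Qed.

Lemma set_distance_in A x : A x -> set_distance x A = 0.
Proof.
move=> Ax; apply/eqP; rewrite eq_le; apply/andP; split.
  by rewrite -enorm0 -[in leRHS](subrr x) set_distance_le.
by apply: set_distance_ge => [|y _]; [exists x|exact: enorm_ge0].
Qed.

(** The triangle inequality bounds both distances from below.  From inside, the radial
    projection onto the sphere attains the bound; from outside, the ball is open and the
    bound is only approached, by radial projections onto spheres of radius [s < r]. *)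
Lemma signed_distance_eball r x : 0 < r ->
  signed_distance (@eball R r) x = enorm x - r.
Proof.
move=> r0; rewrite /signed_distance; have [xr|rx] := ltP (enorm x) r.
  rewrite set_distance_in// sub0r; suff -> : set_distance x (~` eball r) = r - enorm x.
    by rewrite opprB.
  have toSphere : exists2 y, enorm y = r & enorm (x - y) = r - enorm x.
    have [->|x0] := eqVneq x 0.
      exists (r *: basis_vec ord0); first by rewrite enormZ enorm_basis mulr1 gtr0_norm.
      by rewrite sub0r enormN enormZ enorm_basis mulr1 gtr0_norm// enorm0 subr0.
    rewrite -enorm_gt0 in x0; exists ((r / enorm x) *: x).
      by rewrite enormZ gtr0_norm ?divr_gt0// divfK// gt_eqF.
    rewrite -{1}(scale1r x) -scalerBl enormZ ltr0_norm.
      by rewrite mulNr mulrBl mul1r divfK ?gt_eqF// opprB.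
    by rewrite subr_lt0 ltr_pdivlMr// mul1r.
  have [y yr xy] := toSphere; apply/eqP; rewrite eq_le -{1}xy; apply/andP; split.
    by apply: set_distance_le; rewrite /eball/= yr ltxx.
  apply: set_distance_ge => [|z /= /negP]; first by exists y; rewrite /eball/= yr ltxx.
  rewrite -leNgt => rz; rewrite -(enormN (x - z)) opprB.
  by apply: le_trans (ler_enormB _ _); rewrite lerD2r.
rewrite (@set_distance_in (~` _)); last by rewrite /eball/= ltNge rx.
rewrite subr0; have x0 : 0 < enorm x by exact: lt_le_trans rx.
apply/eqP; rewrite eq_le; apply/andP; split.
  apply/ler_addgt0Pr => e e0; set s := Num.max 0 (r - e).
  have s0 : 0 <= s by rewrite le_max lexx.
  have sr : s < r by rewrite gt_max r0 gtrBl.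
  apply: (@le_trans _ _ (enorm (x - (s / enorm x) *: x))).
    apply: set_distance_le; rewrite /eball/= enormZ ger0_norm ?divr_ge0 ?(ltW x0)//.
    by rewrite divfK// gt_eqF.
  rewrite -{1}(scale1r x) -scalerBl enormZ ger0_norm.
    rewrite mulrBl mul1r divfK ?gt_eqF//.
    have : r - e <= s by rewrite le_max lexx orbT.
    lra.
  by rewrite subr_ge0 ler_pdivrMr// mul1r (le_trans (ltW sr)).
apply: set_distance_ge => [|y /= yr]; first by exists 0; rewrite /eball/= enorm0.
by apply: le_trans (ler_enormB _ _); rewrite lerD2l lerN2 ltW.
Qed.

Lemma normal_eball r x : 0 < r -> x != 0 ->
  normal (@eball R r) x = (enorm x)^-1 *: x.
Proof.
move=> r0 x0; apply/rowP => i; rewrite !mxE /partial.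
have -> : signed_distance (@eball R r) = @enorm R + cst (- r).
  by apply/funext => y; rewrite signed_distance_eball.
have dn := is_derive_enorm (basis_vec i) x0.
have dc := is_derive_cst (- r) x (basis_vec i).
have [_ ->] := is_deriveD dn dc.
by rewrite addr0 dot_basis mulrC.
Qed.

Lemma neq0_near x : x != 0 -> \forall y \near x, y != 0.
Proof.
move=> x0; have : \forall y \near x, 0 < enorm y.
  apply: (@enorm_continuous x [set z | 0 < z]); apply: open_nbhs_nbhs; split.
    exact: open_gt.
  by rewrite /= enorm_gt0.
by apply: filterS => y; rewrite enorm_gt0.
Qed.

Lemma is_derive_coord x v i : is_derive x v (fun y : E => y ord0 i) (v ord0 i).
Proof.
apply: cvg_is_derive.
apply: cvg_trans (cvg_cst _ : cst (v ord0 i) @ (0 : R)^' --> v ord0 i).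
apply: near_eq_cvg; near=> h; rewrite !mxE addrK -[_ *: _]/(_ * _) mulKf//.
by near: h; exact: nbhs_dnbhs_neq.
Unshelve. all: by end_near. Qed.

Lemma is_derive_normal r x v i : 0 < r -> x != 0 ->
  is_derive x v (fun y => normal (@eball R r) y ord0 i)
    (v ord0 i / enorm x - x ord0 i * dot x v / enorm x ^+ 3).
Proof.
move=> r0 x0.
apply: (@near_eq_is_derive _ _ _ ((fun y : E => y ord0 i) * (fun y => (enorm y)^-1))).
  near=> y; have y0 : y != 0 by near: y; exact: neq0_near.
  by rewrite normal_eball// !mxE mulrC.
have n0 : enorm x != 0 by rewrite gt_eqF// enorm_gt0.
have [dn vn] := is_derive_enorm v x0.
have dV : is_derive x v (fun y : E => (enorm y)^-1) (- (dot x v) / enorm x ^+ 3).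
  apply: DeriveDef; first exact: derivableV.
  rewrite deriveV// vn -[_ *: _]/(_ * _).
  by field.
have [dM vM] := is_deriveM (is_derive_coord x v i) dV.
apply: DeriveDef; [exact: dM|rewrite vM].
rewrite -![_ *: _]/(_ * _).
by field.
Unshelve. all: by end_near. Qed.

Lemma curvature_eball r x : 0 < r -> x != 0 ->
  curvature (@eball R r) x = - 2 / enorm x.
Proof.
move=> r0 x0; have n0 : enorm x != 0 by rewrite gt_eqF// enorm_gt0.
rewrite /curvature /tangential_partial mulNr; congr (- _).
set nu := normal _ x.
have pE i j : partial j (fun y => normal (@eball R r) y ord0 i) x =
    (i == j)%:R / enorm x - x ord0 i * x ord0 j / enorm x ^+ 3.
  have [_] := is_derive_normal (basis_vec j) i r0 x0.
  by rewrite dot_basis mxE eqxx/= => <-.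
have gE i : grad (fun y => normal (@eball R r) y ord0 i) x =
    (enorm x)^-1 *: basis_vec i - (x ord0 i / enorm x ^+ 3) *: x.
  by apply/rowP => j; rewrite !mxE pE eqxx/= eq_sym; congr (_ - _); ring.
transitivity (\sum_(i < 3) ((enorm x)^-1 - x ord0 i * x ord0 i / enorm x ^+ 3)).
  apply: eq_bigr => i _; rewrite pE eqxx mulr1n gE dotDr dotNr !dotZr dot_basis.
  rewrite /nu normal_eball// dotZl -enorm_sqr mxE.
  by field.
rewrite big_split/= sumr_const card_ord sumrN -mulr_suml -/(dot x x) -enorm_sqr.
by rewrite -mulr_natl; field.
Qed.

(** ** Connectedness *)

(** A star-shaped set is the union of the segments from its centre. *)
Lemma star_connected (A : set E) (c0 : E) : A c0 ->
  (forall x t, A x -> 0 <= t <= 1 -> A (c0 + t *: (x - c0))) -> connected A.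
Proof.
move=> Aa0 star.
have -> : A = \bigcup_(x in A) [set c0 + t *: (x - c0) | t in `[0, 1]].
  apply/seteqP; split=> [x Ax|y [x Ax [t /= tI <-]]].
    exists x => //; exists 1; first by rewrite /= in_itv/= lexx ler01.
    by rewrite scale1r addrC subrK.
  by apply: star => //; rewrite in_itv/= in tI.
apply: bigcup_connected.
  exists c0 => x Ax; exists 0; first by rewrite /= in_itv/= lexx ler01.
  by rewrite scale0r addr0.
move=> x Ax; apply: connected_continuous_connected; first exact: segment_connected.
apply: continuous_subspaceT => t; apply: cvgD; first exact: cvg_cst.
by apply: cvgZl; exact: cvg_id.
Qed.

Lemma eball_connected r : 0 < r -> connected (@eball R r).
Proof.
move=> r0; apply: (@star_connected _ 0); first by rewrite /eball/= enorm0.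
move=> x t; rewrite /eball/= subr0 add0r enormZ => xr /andP[t0 t1].
by rewrite ger0_norm//; apply: le_lt_trans xr; rewrite ler_piMl ?enorm_ge0.
Qed.

(** The space minus a closed half-line is star-shaped, and two opposite half-lines
    give two such sets covering the punctured space. *)
Lemma punctured_connected : connected [set x : E | x != 0].
Proof.
pose S e : set E := [set x | 0 < e * x ord0 ord0 \/ exists2 i, i != ord0 & x ord0 i != 0].
have cS e : e * e = 1 -> connected (S e).
  move=> ee; apply: (@star_connected _ (e *: basis_vec ord0)).
    by left; rewrite !mxE !eqxx mulr1 ee.
  move=> x t Sx /andP[]; rewrite le_eqVlt => /orP[/eqP<- _|t0 t1].
    by left; rewrite scale0r addr0 !mxE !eqxx mulr1 ee.
  case: Sx => [x0|[i i0 xi]]; [left|right].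
    have -> : e * (e *: basis_vec ord0 + t *: (x - e *: basis_vec ord0)) ord0 ord0 =
        (1 - t) * (e * e) + t * (e * x ord0 ord0).
      by rewrite !mxE !eqxx/=; ring.
    by rewrite ee mulr1 ltr_wpDl ?subr_ge0// mulr_gt0.
  exists i => //; rewrite !mxE eqxx (negbTE i0)/= mulr0 add0r oppr0 addr0.
  by rewrite mulf_neq0// gt_eqF.
have -> : [set x : E | x != 0] = S 1 `|` S (- 1).
  apply/seteqP; split=> [x /= x0|x].
    have [i|] := pselect (exists i, i != ord0 /\ x ord0 i != 0).
      by case: i => i [i0 xi]; left; right; exists i.
    move=> /forallNP h; have xi i : i != ord0 -> x ord0 i = 0.
      by move=> i0; apply/eqP/negPn/negP => xi; apply: (h i).
    have [x00|x00|x00] := ltgtP (x ord0 ord0) 0.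
    - by right; left; rewrite mulN1r oppr_gt0.
    - by left; left; rewrite mul1r.
    - case/negP: x0; apply/eqP/rowP => i; rewrite mxE.
      by have [->|/xi] := eqVneq i ord0.
  by case=> -[|[i _]] h; apply/eqP => x0; move: h; rewrite x0 mxE ?mulr0 ?ltxx ?eqxx.
apply: connectedU; [|by apply: cS; rewrite mulr1|by apply: cS; rewrite mulrNN mulr1].
by exists (basis_vec ord_max); split; right; exists ord_max; rewrite // mxE !eqxx oner_neq0.
Qed.

(** Changing the radius by the increasing bijection [s |-> a + (b - a) s / (1 + s)] from
    the positive half-line onto the interval maps the punctured space onto the shell. *)
Lemma shell_connected a b : 0 < a -> a < b -> connected (shell a b).
Proof.
move=> a0 ab; have ba : 0 < b - a by rewrite subr_gt0.
pose phi (x : E) := ((a + (b - a) * (enorm x / (1 + enorm x))) / enorm x) *: x.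
have -> : shell a b = phi @` [set x | x != 0].
  apply/seteqP; split=> [y /andP[ay yb]|_ [x /= x0 <-]].
    have y0 : 0 < enorm y by exact: lt_trans ay.
    have by0 : 0 < b - enorm y by rewrite subr_gt0.
    pose s := (enorm y - a) / (b - enorm y).
    have s0 : 0 < s by rewrite divr_gt0// subr_gt0.
    exists ((s / enorm y) *: y) => /=.
      by rewrite -enorm_gt0 enormZ mulr_gt0// normr_gt0 gt_eqF// divr_gt0.
    have ns : enorm ((s / enorm y) *: y) = s.
      by move: s s0 => t t0; rewrite enormZ gtr0_norm ?divr_gt0// divfK// gt_eqF.
    rewrite /phi ns scalerA -[RHS]scale1r; congr (_ *: _).
    have -> : a + (b - a) * (s / (1 + s)) = enorm y.
      rewrite /s; field.
      by rewrite (gt_eqF by0) addrA subrK gt_eqF.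
    by rewrite mulrA divfK ?divff// gt_eqF.
  rewrite -enorm_gt0 in x0; rewrite /shell/= /phi enormZ.
  set q := enorm x / (1 + enorm x).
  have q0 : 0 < q by rewrite divr_gt0// addr_gt0.
  have q1 : q < 1 by rewrite ltr_pdivrMr ?addr_gt0// mul1r ltrDr.
  have aq : 0 < a + (b - a) * q by rewrite addr_gt0// mulr_gt0.
  rewrite gtr0_norm ?divr_gt0// divfK ?gt_eqF// ltrDl mulr_gt0//=.
  by rewrite -ltrBrDl gtr_pMr.
apply: connected_continuous_connected punctured_connected _.
apply: continuous_in_subspaceT => x; rewrite inE/= -enorm_gt0 => x0.
have cn := @enorm_continuous x.
rewrite /prop_for /continuous_at /phi.
apply: (@cvgZ _ _ _ (nbhs x)); last exact: cvg_id.
apply: cvgM; last by apply: cvgV; rewrite ?gt_eqF.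
apply: cvgD; first exact: cvg_cst.
apply: cvgM; first exact: cvg_cst.
apply: cvgM => //; apply: cvgV; first by rewrite gt_eqF// addr_gt0.
by apply: cvgD => //; exact: cvg_cst.
Qed.

End Euclid.

(** * Volume of Euclidean balls *)

Section Volume.
Context {R : realType}.
Local Notation E := 'rV[R]_3.
Local Notation lam := (@lebesgue_measure R).

(** Extending an integrand by zero lets iterated integrals over the whole space be computed
    one variable at a time without tracking the domains of the slices. *)
Lemma integral_FTC_support (f F : R -> R) (a b : R) : a < b ->
  continuous f -> continuous F -> (forall x : R, a < x < b -> is_derive x 1 F (f x)) ->
  (forall x, ~~ (a <= x <= b) -> f x = 0) ->
  (\int[lam]_x (f x)%:E = (F b - F a)%:E)%E.
Proof.
move=> ab cf cF dF f0.
transitivity (\int[lam]_(x in `[a, b]) (f x)%:E)%E.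
  rewrite [RHS]integral_mkcond; apply: eq_integral => x _.
  rewrite patchE; case: ifPn => //; rewrite notin_setE/= in_itv/= => /negP xab.
  by rewrite f0.
rewrite (@continuous_FTC2 _ f F)//.
- exact: continuous_subspaceT.
- split.
  + by move=> x; rewrite in_itv/= => /dF[].
  + by apply: cvg_at_right_filter; exact: cF.
  + by apply: cvg_at_left_filter; exact: cF.
- by move=> x; rewrite in_itv/= => /dF dFx; rewrite derive1E derive_val.
Qed.

(** The usual primitive of [2 * sqrt (s ^ 2 - x ^ 2)] with [asin (x / s)] written as
    [2 * atan (x / (s + w))], which is continuous up to the end points [x = -s, s]. *)
Lemma half_disc_integral (p : R) :
  (\int[lam]_x (2 * Num.sqrt (p - x ^+ 2))%:E = (pi * Num.max p 0)%:E)%E.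
Proof.
have [p0|p0] := leP p 0.
  rewrite mulr0 integral0_eq// => x _; rewrite ler0_sqrtr ?mulr0//.
  by rewrite subr_le0; apply: le_trans p0 (sqr_ge0 _).
pose s := Num.sqrt p; have s0 : 0 < s by rewrite sqrtr_gt0.
have ps : p = s ^+ 2 by rewrite sqr_sqrtr// ltW.
pose w (x : R) := Num.sqrt (s ^+ 2 - x ^+ 2).
have cw : continuous w.
  move=> x; apply: (@cvg_comp _ _ _ (fun x : R => s ^+ 2 - x ^+ 2) Num.sqrt
    _ (nbhs (s ^+ 2 - x ^+ 2))); last exact: sqrt_continuous.
  by apply: cvgB; [exact: cvg_cst|exact: exprn_continuous].
have sw0 x : 0 < s + w x by rewrite ltr_pwDl// sqrtr_ge0.
pose u (x : R) := x / (s + w x).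
have cu : continuous u.
  move=> x; apply: cvgM; first exact: cvg_id.
  apply: cvgV; first by rewrite gt_eqF.
  by apply: cvgD; [exact: cvg_cst|exact: cw].
pose F (x : R) := x * w x + 2 * s ^+ 2 * atan (u x).
have ws x : x ^+ 2 = s ^+ 2 -> w x = 0 by rewrite /w => ->; rewrite subrr sqrtr0.
transitivity ((F s - F (- s))%:E)%E; last first.
  rewrite /F /u !ws ?sqrrN// !mulr0 !add0r !addr0 mulNr divff ?gt_eqF//.
  rewrite atanN atan1 ps; congr EFin; lra.
apply: integral_FTC_support.
- by rewrite gtrN.
- rewrite ps => x; apply: cvgM; [exact: cvg_cst|exact: cw].
- move=> x; apply: cvgD.
    by apply: cvgM; [exact: cvg_id|exact: cw].
  apply: cvgM; first exact: cvg_cst.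
  by apply: cvg_comp; [exact: cu|exact: continuous_atan].
- move=> x /andP[sx xs].
  have q0 : 0 < s ^+ 2 - x ^+ 2.
    by rewrite subr_sqr mulr_gt0 ?subr_gt0// -ltrBlDl sub0r.
  have w0 : 0 < w x by rewrite sqrtr_gt0.
  have wE : w x ^+ 2 = s ^+ 2 - x ^+ 2 by rewrite sqr_sqrtr// ltW.
  have dq : is_derive x 1 (fun x : R => s ^+ 2 - x ^+ 2) (- (2 * x)).
    have h := is_deriveB (is_derive_cst (s ^+ 2) x 1) (is_deriveX 2 (is_derive_id x (1 : R))).
    apply: (is_derive_eq h); rewrite sub0r expr1 -[_ *: _]/(_ * _); ring.
  have dw : is_derive x 1 w (- x / w x).
    have h := @is_derive1_comp R Num.sqrt (fun x => s ^+ 2 - x ^+ 2) x _ _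
      (is_derive1_sqrt q0) dq.
    apply: (is_derive_eq h); rewrite -/(w x); field.
    by rewrite gt_eqF.
  have du : is_derive x 1 u (s / (w x * (s + w x))).
    have dsw : is_derive x 1 (fun y => s + w y) (- x / w x).
      by apply: (is_derive_eq (is_deriveD (is_derive_cst s x 1) dw)); rewrite add0r.
    have [dV vV] := is_deriveV (f := fun y : R => s + w y)
      (lt0r_neq0 (sw0 x)) dsw.
    have [dM vM] := is_deriveM (is_derive_id x (1 : R)) (DeriveDef dV vV).
    apply: DeriveDef; first exact: dM.
    rewrite vM -![_ *: _]/(_ * _).
    have -> : s / (w x * (s + w x)) =
       ((s + w x) * w x + (s ^+ 2 - w x ^+ 2)) / (w x * (s + w x) ^+ 2).
      by field; rewrite !gt_eqF.
    have -> : s ^+ 2 - w x ^+ 2 = x ^+ 2 by rewrite wE; ring.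
    by field; rewrite !gt_eqF.
  have da := @is_derive1_comp R atan u x _ _ (is_derive1_atan (u x)) du.
  have h := is_deriveD (is_deriveM (is_derive_id x (1 : R)) dw)
     (is_deriveZ (2 * s ^+ 2) da).
  have [dF vF] := h; apply: DeriveDef; first exact: dF.
  rewrite vF -![_ *: _]/(_ * _) ps -/(w x).
  have -> : (1 + u x ^+ 2)^-1 = (s + w x) / (2 * s).
    have -> : 1 + u x ^+ 2 = (s ^+ 2 + 2 * s * w x + w x ^+ 2 + x ^+ 2) / (s + w x) ^+ 2.
      by rewrite /u; field; rewrite gt_eqF.
    have -> : s ^+ 2 + 2 * s * w x + w x ^+ 2 + x ^+ 2 = 2 * s * (s + w x).
      by rewrite wE; ring.
    by field; rewrite !gt_eqF.
  have -> : x * (- x / w x) = (w x ^+ 2 - s ^+ 2) / w x by rewrite wE; ring.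
  by field; rewrite !gt_eqF.
- move=> x xs; rewrite ler0_sqrtr ?mulr0// subr_le0 ps.
  rewrite -ler_norml -ltNge in xs.
  by rewrite -(real_normK (num_real x)) ler_pXn2r ?nnegrE// ltW.
Qed.

(** The integrand is the area of the slice of the ball at height [z]. *)
Lemma ball_sections_integral (r : R) : 0 < r ->
  (\int[lam]_z (pi * Num.max (r ^+ 2 - z ^+ 2) 0)%:E = (4 / 3 * pi * r ^+ 3)%:E)%E.
Proof.
move=> r0; pose F (z : R) := pi * (r ^+ 2 * z - z ^+ 3 / 3).
transitivity ((F r - F (- r))%:E)%E; last first.
  by congr EFin; rewrite /F; move: pi => p; field.
apply: integral_FTC_support.
- by rewrite gtrN.
- move=> x; apply: cvgM; first exact: cvg_cst.
  apply: (@continuous_max _ _ (fun x : R => r ^+ 2 - x ^+ 2) (cst 0) x);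
    last exact: cvg_cst.
  by apply: cvgB; [exact: cvg_cst|exact: exprn_continuous].
- move=> x; apply: cvgM; first exact: cvg_cst.
  apply: cvgB; first by apply: cvgM; [exact: cvg_cst|exact: cvg_id].
  by apply: cvgM; [exact: exprn_continuous|exact: cvg_cst].
- move=> x /andP[sx xs].
  have q0 : 0 < r ^+ 2 - x ^+ 2.
    by rewrite subr_sqr mulr_gt0 ?subr_gt0// -ltrBlDl sub0r.
  have h := is_deriveZ pi (is_deriveB (is_deriveZ (r ^+ 2) (is_derive_id x (1 : R)))
     (is_deriveZ 3^-1 (is_deriveX 3 (is_derive_id x (1 : R))))).
  have eF : F = pi \*: (r ^+ 2 \*: id - 3^-1 \*: (id ^+ 3)).
    by apply/funext => z; change (F z = pi * (r ^+ 2 * z - 3^-1 * z ^+ 3)); rewrite (mulrC 3^-1).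
  rewrite eF; have [dF vF] := h; apply: DeriveDef; first exact: dF.
  rewrite vF -![_ *: _]/(_ * _) max_l ?ltW//.
  by move: pi => p; field.
- move=> x xs; rewrite max_r ?mulr0// subr_le0.
  rewrite -ler_norml -ltNge in xs.
  by rewrite -(real_normK (num_real x)) ler_pXn2r ?nnegrE// ltW.
Qed.

Lemma lebesgue_sqr_lt (p : R) :
  lam [set y : R | y ^+ 2 < p] = (2 * Num.sqrt p)%:E.
Proof.
rewrite (_ : [set _ | _] = `]- Num.sqrt p, Num.sqrt p[%classic).
  rewrite lebesgue_measure_itv/= lte_fin; case: ifPn => [_|].
    by rewrite -EFinD opprK mulr_natl mulr2n.
  rewrite -leNgt => h; have -> : Num.sqrt p = 0; last by rewrite mulr0.
  by have := sqrtr_ge0 p; lra.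
apply/seteqP; split=> y; rewrite /= in_itv/= -ltr_norml.
  move=> h; rewrite -sqrtr_sqr ltr_sqrt//.
  by apply: le_lt_trans h; exact: sqr_ge0.
by rewrite -sqrtr_sqr => h; rewrite -ltr_sqrt// -sqrtr_gt0 (le_lt_trans _ h)// sqrtr_ge0.
Qed.

Local Notation T3 :=
  (measurableTypeR R * measurableTypeR R * measurableTypeR R)%type.

Definition sqnorm3 (p : T3) : R := p.1.1 ^+ 2 + p.1.2 ^+ 2 + p.2 ^+ 2.

Lemma enorm_vec3 (p : T3) : enorm (vec3 p) = Num.sqrt (sqnorm3 p).
Proof.
rewrite /enorm /dot !big_ord_recl big_ord0 !mxE /=; congr Num.sqrt.
by rewrite /sqnorm3 addr0 addrA !expr2.
Qed.

Lemma preimage_eball r : 0 < r -> vec3 @^-1` (eball r) = [set p | sqnorm3 p < r ^+ 2].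
Proof.
move=> r0; have h p : (enorm (vec3 p) < r) = (sqnorm3 p < r ^+ 2).
  rewrite enorm_vec3 -[X in _ < X](gtr0_norm r0) -sqrtr_sqr ltr_sqrt//.
  by rewrite exprn_gt0.
by apply/seteqP; split=> p; rewrite /= /eball/= h.
Qed.

Lemma preimage_closed_eball r : 0 < r ->
  vec3 @^-1` [set x : E | enorm x <= r] = [set p | sqnorm3 p <= r ^+ 2].
Proof.
move=> r0; have h p : (enorm (vec3 p) <= r) = (sqnorm3 p <= r ^+ 2).
  rewrite enorm_vec3 -[X in _ <= X](gtr0_norm r0) -sqrtr_sqr ler_sqrt//.
  by rewrite exprn_ge0// ltW.
by apply/seteqP; split=> p; rewrite /= h.
Qed.

Lemma measurable_sqnorm3 : measurable_fun setT sqnorm3.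
Proof.
apply: measurable_funD; first apply: measurable_funD;
  apply: measurable_funX.
- exact: measurableT_comp measurable_fst measurable_fst.
- exact: measurableT_comp measurable_snd measurable_fst.
- exact: measurable_snd.
Qed.

Lemma measurable_preimage_eball r : 0 < r ->
  measurable (vec3 @^-1` (eball r) : set T3).
Proof.
move=> r0; rewrite preimage_eball//.
rewrite (_ : [set _ | _] = setT `&` sqnorm3 @^-1` `]-oo, r ^+ 2[).
  by apply: measurable_sqnorm3 => //; exact: measurable_itv.
by apply/seteqP; split=> p /=; rewrite in_itv/=; [split|case].
Qed.

Lemma measurable_preimage_closed_eball r : 0 < r ->
  measurable (vec3 @^-1` [set x : E | enorm x <= r] : set T3).
Proof.
move=> r0; rewrite preimage_closed_eball//.
rewrite (_ : [set _ | _] = setT `&` sqnorm3 @^-1` `]-oo, r ^+ 2]).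
  by apply: measurable_sqnorm3 => //; exact: measurable_itv.
by apply/seteqP; split=> p /=; rewrite in_itv/=; [split|case].
Qed.

Lemma volume_eball r : 0 < r -> volume (@eball R r) = (4 / 3 * pi * r ^+ 3)%:E.
Proof.
move=> r0; transitivity (\int[lam \x lam]_q
    lam (xsection (vec3 @^-1` (eball r)) q))%E; first by [].
transitivity (\int[lam \x lam]_q
    (2 * Num.sqrt (r ^+ 2 - q.1 ^+ 2 - q.2 ^+ 2))%:E)%E.
  apply: eq_integral => q _ /=; rewrite -lebesgue_sqr_lt; congr (lam _).
  rewrite preimage_eball//.
  by apply/seteqP; split=> z; rewrite xsectionE/= /sqnorm3/=; lra.
rewrite fubini_tonelli1//.
- rewrite -ball_sections_integral//; apply: eq_integral => x _.
  by rewrite /fubini_F/= half_disc_integral.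
- apply/measurable_EFinP; apply: measurable_funM => //.
  have msqrt : measurable_fun setT (@Num.sqrt R).
    by apply: continuous_measurable_fun; exact: sqrt_continuous.
  apply: (measurableT_comp msqrt).
  apply: measurable_funB.
    apply: measurable_funB => //.
    exact: measurable_funX.
  exact: measurable_funX.
Qed.

(** A closed ball lies between the open ball of the same radius and all larger ones. *)
Lemma volume_closed_eball r : 0 < r ->
  volume [set x : E | enorm x <= r] = (4 / 3 * pi * r ^+ 3)%:E.
Proof.
move=> r0; apply/eqP; rewrite eq_le; apply/andP; split.
  pose g (s : R) := 4 / 3 * pi * s ^+ 3.
  have cg : g s @[s --> r^'+] --> g r.
    apply: cvg_at_right_filter; apply: cvgM; first exact: cvg_cst.
    exact: exprn_continuous.
  have vle s : r < s -> (volume [set x : E | (enorm x <= r)%R] <= (g s)%:E)%E.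
    move=> rs; rewrite -volume_eball; last exact: lt_trans rs.
    apply: le_measure; rewrite ?inE.
    - exact: measurable_preimage_closed_eball.
    - by apply: measurable_preimage_eball; exact: lt_trans rs.
    - by move=> p /= pr; exact: le_lt_trans pr rs.
  have := vle (r + 1); rewrite ltrDl ltr01 => /(_ isT) vfin.
  have v0 : (0 <= volume [set x : E | (enorm x <= r)%R])%E by exact: measure_ge0.
  case: (volume _) v0 vfin vle => // v _ _ vle; rewrite lee_fin.
  rewrite -/(g r); apply: (cvgr_to_ge cg); near=> s; apply: vle; near: s; exact: nbhs_right_gt.

rewrite -volume_eball//; apply: le_measure; rewrite ?inE.
- exact: measurable_preimage_eball.
- exact: measurable_preimage_closed_eball.
- by move=> p /= /ltW.
Unshelve. all: by end_near. Qed.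

Lemma volume_shell (a b : R) : 0 < a -> a < b ->
  volume (shell a b) = (4 / 3 * pi * (b ^+ 3 - a ^+ 3))%:E.
Proof.
move=> a0 ab; have b0 := lt_trans a0 ab.
have mb := measurable_preimage_eball b0.
have ma := measurable_preimage_closed_eball a0.
rewrite {1}/volume (_ : vec3 @^-1` shell a b =
  vec3 @^-1` (eball b) `\` vec3 @^-1` [set x : E | enorm x <= a]); last first.
  apply/seteqP; split=> p /=; first by move=> /andP[ap pb]; split=> //; apply/negP; rewrite -ltNge.
  by move=> [pb /negP]; rewrite -ltNge => ap; apply/andP.
have fin : (volume (@eball R b) < +oo)%E by rewrite volume_eball// ltry.
rewrite measureD//.
rewrite (_ : _ `&` _ = vec3 @^-1` [set x : E | enorm x <= a]); last first.
  by apply/seteqP; split=> p /= => [[]|pa]//; split=> //; exact: le_lt_trans ab.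
transitivity (volume (@eball R b) - volume [set x : E | (enorm x <= a)%R])%E => //.
by rewrite volume_eball// volume_closed_eball// -EFinB -mulrBr.
Qed.

Lemma integral3_eball_cst r (f : E -> R) q : 0 < r ->
  (forall x, eball r x -> f x = q) -> integral3 (@eball R r) f = (4 * pi / 3 * r ^+ 3 * q)%:E.
Proof.
move=> r0 fq; have mB := measurable_preimage_eball r0.
rewrite /integral3 (eq_integral (cst q%:E)).
  rewrite integral_cst//.
  transitivity (q%:E * volume (@eball R r))%E => //.
  by rewrite volume_eball// -EFinM; congr EFin; ring.
by move=> p; rewrite inE/= => /fq ->.
Qed.

End Volume.

(** * Rigidity of stationary fields *)

Section Fields.
Context {R : realType}.
Local Notation E := 'rV[R]_3.
Local Notation e1 := (@basis_vec R ord0).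

(** Field equations hold in the open domains and the boundary conditions on their closures;
    continuity carries identities from the former to the latter. *)
Lemma closure_limit_eq {V W : normedModType R} (A : set V) (f g : V -> W) x :
  {for x, continuous f} -> {for x, continuous g} -> closure A x ->
  (forall y, A y -> f y = g y) -> f x = g x.
Proof.
move=> cf cg Ax fg; apply/eqP; rewrite -subr_eq0 -normr_le0.
have cfg : {for x, continuous (fun y => f y - g y)} by exact: continuousB.
apply/ler_addgt0Pr => e e0; rewrite add0r.
have /cvgrPdist_le /(_ e e0) /Ax [y [Ay]] := cfg.
by rewrite (fg y Ay) subrr subr0.
Qed.

Lemma derive_eq_on_open {V W : normedModType R} (A : set V) (f g : V -> W) v x :
  open A -> (forall y, A y -> f y = g y) -> A x -> 'D_v f x = 'D_v g x.
Proof.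
move=> oA fg Ax; apply: near_eq_derive.
by apply: filterS fg _; exact: open_nbhs_nbhs.
Qed.

(** The stress tensor is evaluated on the boundary, where constancy of the field in the
    domain says nothing about difference quotients across it. *)
Lemma Cn_on_cst_derive_closure {V W : normedModType R} n (A U : set V) (f : V -> W) c v x :
  open A -> closure A `<=` U -> Cn_on n.+1 U f -> (forall y, A y -> f y = c) ->
  closure A x -> 'D_v f x = 0.
Proof.
move=> oA AU cf fc Ax.
have c' : {for x, continuous ('D_v f)} by apply: Cn_on_continuous (AU _ Ax); exact: Cn_on_derive cf.
have c0 : {for x, continuous (cst 0 : V -> W)} by exact: cst_continuous.
apply: (closure_limit_eq c' c0 Ax) => y Ay.
by rewrite (derive_eq_on_open v oA fc Ay) derive_cst.
Qed.

Lemma Cn_on_coord n (U : set E) (f : E -> E) i :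
  open U -> Cn_on n U f -> Cn_on n U (fun y => f y ord0 i).
Proof.
move=> oU; have cc (g : E -> E) : (forall x, U x -> {for x, continuous g}) ->
    forall x, U x -> {for x, continuous (fun y => g y ord0 i)}.
  by move=> cg x Ux; apply: (@continuous_comp _ _ _ g (fun M : E => M ord0 i) x (cg x Ux));
    exact: coord_continuous.
elim: n f => [|n IH] f cf; first by split => //; apply: cc; case: cf.
apply: Cn_onS => //; first by apply: cc; case: cf.
move=> v; exists (fun y => 'D_v f y ord0 i); first by apply: IH; exact: Cn_on_derive.
move=> x Ux; have [df _] := Cn_on_is_derive v cf Ux.
apply: DeriveDef; first by move/derivable_mxP: df; exact.
by rewrite derive_mx// mxE.
Qed.

Lemma partial_coord (f : E -> E) i j x :
  derivable f x (basis_vec i) -> partial i (fun y => f y ord0 j) x = partial i f x ord0 j.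
Proof. by move=> df; rewrite /partial -/(basis_vec i) derive_mx// mxE. Qed.

Lemma is_derive_line {V W : normedModType R} (f : V -> W) x v h l :
  is_derive (h *: v + x) v f l -> is_derive h 1 (fun t : R => f (t *: v + x)) l.
Proof.
move=> [df <-]; apply: cvg_is_derive.
rewrite (_ : (fun t : R => _) =
  fun t => t^-1 *: ((f \o shift (h *: v + x)) (t *: v) - f (h *: v + x))).
  exact: df.
by apply/funext => t /=; rewrite -[t *: 1]/(t * 1) mulr1 scalerDl addrA.
Qed.

Lemma continuous_line {V W : normedModType R} (f : V -> W) x v (h : R) :
  {for h *: v + x, continuous f} -> {for h, continuous (fun t : R => f (t *: v + x))}.
Proof.
move=> cf; apply: (@cvg_comp _ _ _ (fun t : R => t *: v + x) f _ _ _ _ cf).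
apply: cvgD; last exact: cvg_cst.
by apply: cvgZl; exact: cvg_id.
Qed.

Lemma ray_lineE {V : normedModType R} {W : Type} (f : V -> W) v :
  (fun t : R => f (t *: v)) = (fun t : R => f (t *: v + 0)).
Proof. by apply/funext => t; rewrite addr0. Qed.

Lemma is_derive_ray {V W : normedModType R} (f : V -> W) v s l :
  is_derive (s *: v) v f l -> is_derive s 1 (fun t : R => f (t *: v)) l.
Proof. by rewrite ray_lineE -{1}[s *: v]addr0; exact: is_derive_line. Qed.

Lemma continuous_ray {V W : normedModType R} (f : V -> W) v (s : R) :
  {for s *: v, continuous f} -> {for s, continuous (fun t : R => f (t *: v))}.
Proof. by rewrite ray_lineE -{1}[s *: v]addr0; exact: continuous_line. Qed.

Lemma zero_derive_constant (f : R -> R) a b : a < b ->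
  (forall s, a < s <= b -> {for s, continuous f}) ->
  (forall s, a < s < b -> is_derive s 1 f 0) -> forall s, a < s <= b -> f s = f b.
Proof.
move=> ab cf df s /andP[sa]; rewrite le_eqVlt => /orP[/eqP->//|sb].
have [||c _] := @MVT _ f (cst 0) s b sb.
- move=> x; rewrite in_itv/= => /andP[sx xb]; apply: df.
  by rewrite xb andbT (lt_trans sa).
- apply: continuous_in_subspaceT => x; rewrite inE/= in_itv/= => /andP[sx xb].
  by apply: cf; rewrite xb andbT (lt_le_trans sa).
by rewrite mul0r => /eqP; rewrite subr_eq0 => /eqP.
Qed.

Lemma enorm_ray s : 0 <= s -> enorm (s *: e1) = s.
Proof. by move=> s0; rewrite enormZ enorm_basis mulr1 ger0_norm. Qed.

(** On the first axis the divergence of a radial field [w (|x|) x / |x|] is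
    [w' + 2 w / s], so that a divergence-free radial field has [s ^ 2 w] constant. *)
Lemma radial_div_free_eq0 (U : set E) (a b : R) (u : E -> E) : open U ->
  0 <= a -> a < b -> (forall s, a < s <= b -> U (s *: e1)) ->
  (forall i, Cn_on 1 U (fun y => u y ord0 i)) -> radial_vector (shell a b) u ->
  (forall x, shell a b x -> div u x = 0) -> u (b *: e1) ord0 ord0 = 0 ->
  forall x, shell a b x -> u x = 0.
Proof.
move=> oU a0 ab UI cu [g gu] du ub.
pose w (s : R) := u (s *: e1) ord0 ord0.
have shellI s : a < s < b -> shell a b (s *: e1).
  by move=> /andP[sa sb]; rewrite /shell/= enorm_ray ?sa// (le_trans a0)// ltW.
have cw s : a < s <= b -> {for s, continuous w}.
  move=> sI; apply: (@continuous_ray _ _ (fun y => u y ord0 ord0)).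
  by apply: Cn_on_continuous (cu _) _; exact: UI.
have wE s : a < s < b -> w s = g s.
  move=> sI; have s0 : 0 < s by case/andP: sI => /(le_lt_trans a0).
  rewrite /w gu; last exact: shellI.
  by rewrite enorm_ray ?ltW// !mxE !eqxx mulr1 divfK// gt_eqF.
(* Off the axis [u] points along [x], so its component along [basis_vec i] is the axial
   component times [h / s]. *)
have transv s i : i != ord0 -> a < s < b ->
    partial i (fun y => u y ord0 i) (s *: e1) = w s / s.
  move=> i0 sI; have s0 : 0 < s by case/andP: sI => /(le_lt_trans a0).
  have sI' : a < s <= b by case/andP: sI => -> /ltW ->.
  suff [] : is_derive (s *: e1) (basis_vec i) (fun y => u y ord0 i) (w s / s) by [].
  apply: cvg_is_derive.
  have shift_cvg := @line_cvg _ _ (s *: e1) (basis_vec i).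
  have cu0 : u (h *: basis_vec i + s *: e1) ord0 ord0 / s @[h --> (0 : R)^'] --> w s / s.
    apply: cvgM; last exact: cvg_cst.
    have c0 : {for s *: e1, continuous (fun y => u y ord0 ord0)}.
      by apply: Cn_on_continuous (cu _) _; exact: UI.
    exact: cvg_comp shift_cvg c0.
  apply: cvg_trans cu0; apply: near_eq_cvg; near=> h.
  have h0 : h != 0 by near: h; exact: nbhs_dnbhs_neq.
  have Sh : shell a b (h *: basis_vec i + s *: e1).
    near: h; apply: (shift_cvg (shell a b)); apply: open_nbhs_nbhs; split.
      exact: shell_open.
    exact: shellI.
  have Ss := shellI s sI.
  rewrite (gu _ Sh) (gu _ Ss) !mxE !eqxx (negbTE i0) eq_sym (negbTE i0)/=.
  rewrite -[_^-1 *: _]/(_^-1 * _) !mulr0 subr0 !mulr1 add0r addr0 mulfK ?gt_eqF//.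
  by rewrite mulrCA mulVf// mulr1.
have radial s : a < s < b -> is_derive s 1 w (- (2 * w s / s)).
  move=> sI; have sI' : a < s <= b by case/andP: sI => -> /ltW ->.
  have := du _ (shellI s sI).
  rewrite /div big_ord_recl => dv.
  have -> : - (2 * w s / s) = partial ord0 (fun y => u y ord0 ord0) (s *: e1).
    move: dv; rewrite (eq_bigr (fun=> w s / s)) => [|i _]; last exact: transv.
    by rewrite sumr_const card_ord => /eqP; rewrite addr_eq0 => /eqP ->; congr (- _); ring.
  exact: is_derive_ray (Cn_on_is_derive e1 (cu ord0) (UI s sI')).
have ws0 s : a < s < b -> w s = 0.
  move=> sI; have s0 : 0 < s by case/andP: sI => /(le_lt_trans a0).
  have sI' : a < s <= b by case/andP: sI => -> /ltW ->.
  have : s ^+ 2 * w s = b ^+ 2 * w b.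
    apply: (@zero_derive_constant (fun s : R => s ^+ 2 * w s) a b) => //.
      by move=> x xI; apply: cvgM; [exact: exprn_continuous|exact: cw].
    move=> x xI; have x0 : 0 < x by case/andP: xI => /(le_lt_trans a0).
    have d2 : is_derive x 1 (fun s : R => s ^+ 2) (2 * x).
      apply: (is_derive_eq (is_deriveX 2 (is_derive_id x (1 : R)))).
      by rewrite expr1 -[_ *: _]/(_ * _) mulr1.
    have [dM vM] := is_deriveM d2 (radial x xI).
    apply: DeriveDef; first exact: dM.
    rewrite vM -![_ *: _]/(_ * _); field.
    by rewrite gt_eqF.
  rewrite {2}/w ub mulr0 => /eqP; rewrite mulf_eq0 expf_eq0/= gt_eqF//=.
  by move/eqP.
move=> x /[dup] /andP[ax xb] Sx; rewrite gu// -wE ?ws0 ?ax// ?xb//.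
by rewrite mul0r scale0r.
Unshelve. all: by end_near. Qed.

(** At a maximum [g 0 = 0], so [l > 0] would make [g] positive to the right of [0] and [f]
    increasing there. *)
Lemma second_derive_at_max (f g : R -> R) (l : R) :
  (\forall h \near (0 : R), f h <= f 0) -> (\forall h \near (0 : R), is_derive (h : R) 1 f (g h)) ->
  is_derive (0 : R) 1 g l -> l <= 0.
Proof.
move=> fmax df dg; rewrite leNgt; apply/negP => l0.
have [d d0 dP] : exists2 d : R, 0 < d & forall h : R, `|h| < d ->
    f h <= f 0 /\ is_derive h 1 f (g h).
  have [d /= d0 dP] := filterI fmax df.
  by exists d => // h hd; apply: dP; rewrite /ball_/= sub0r normrN.
have g0 : g 0 = 0.
  have [|_ [_ gE]] := dP 0; first by rewrite normr0.
  have : is_derive (0 : R) 1 f 0.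
    apply: (@derive1_at_max R f (- d) d 0).
    - by rewrite -subr_ge0 opprK addr_ge0 ?ltW.
    - by move=> t; rewrite in_itv/= -ltr_norml => /dP[_ []].
    - by rewrite in_itv/= oppr_lt0 d0.
    - by move=> t; rewrite in_itv/= -ltr_norml => /dP[].
  by move=> [_]; rewrite gE.
have [gd gl] := dg.
have quo : h^-1 *: (g (h *: 1 + 0) - g 0) @[h --> (0 : R)^'] --> l.
  by rewrite -gl; exact: gd.
have pos : \forall h \near (0 : R)^', 0 < h^-1 *: (g (h *: 1 + 0) - g 0).
  by apply: (quo [set z | 0 < z]); apply: open_nbhs_nbhs; split=> //; exact: open_gt.
have [e e0 eP] : exists2 e : R, 0 < e & forall h, 0 < h -> h < e -> 0 < g h.
  move: pos => [e /= e0 eP].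
  exists e => // h h0 he; have := eP h; rewrite /ball_/= sub0r normrN gtr0_norm//.
  move=> /(_ he); rewrite gt_eqF// => /(_ isT).
  by rewrite g0 subr0 addr0 -[h *: 1]/(h * 1) mulr1 pmulr_rgt0 ?invr_gt0.
pose m := Num.min d e / 2.
have m0 : 0 < m by rewrite divr_gt0// lt_min d0.
have md : m < d by rewrite ltr_pdivrMr// (le_lt_trans (_ : _ <= d))// ?ge_min ?lexx//; lra.
have me : m < e by rewrite ltr_pdivrMr// (le_lt_trans (_ : _ <= e))// ?ge_min ?lexx ?orbT//; lra.
have [||c] := @MVT _ f g 0 m m0.
- move=> x; rewrite in_itv/= => /andP[x0 xm].
  by have [] := dP x; rewrite ?gtr0_norm// (lt_trans xm).
- apply: continuous_in_subspaceT => x; rewrite inE/= in_itv/= => /andP[x0 xm].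
  have [|_ [dfx _]] := dP x; first by rewrite ger0_norm// (le_lt_trans xm).
  by apply: differentiable_continuous; apply/derivable1_diffP.
rewrite in_itv/= subr0 => /andP[c0 cm] fm.
have [] := dP m; first by rewrite gtr0_norm.
by move=> + _; rewrite -subr_le0 fm leNgt mulr_gt0// eP// (lt_trans cm).
Qed.

End Fields.

(** * Maximum principle *)

Section MaximumPrinciple.
Context {R : realType}.
Local Notation E := 'rV[R]_3.
Implicit Types (U : set E) (T : E -> R).

Lemma is_derive_affine_sqr (a b e h : R) :
  is_derive h 1 (fun t : R => e * (t ^+ 2 + 2 * t * b + a)) (e * (2 * h + 2 * b)).
Proof.
have d2 : is_derive h 1 (fun s : R => s ^+ 2) (2 * h).
  apply: (is_derive_eq (is_deriveX 2 (is_derive_id h (1 : R)))).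
  by rewrite expr1 -[_ *: _]/(_ * _) mulr1.
have d1 : is_derive h 1 (fun s : R => 2 * s * b) (2 * b).
  have dM := is_deriveZ (2 * b) (is_derive_id h (1 : R)).
  rewrite (_ : (fun s : R => _) = (2 * b) \*: id); last first.
    by apply/funext => s; rewrite /= -[_ *: _]/(_ * _) mulrAC.
  by apply: (is_derive_eq dM); rewrite -[_ *: _]/(_ * _) mulr1.
have d := is_deriveZ e (is_deriveD (is_deriveD d2 d1) (is_derive_cst a h (1 : R))).
by apply: (is_derive_eq d); rewrite addr0.
Qed.

(** Adding [e * |x| ^ 2] makes the Laplacian positive, which excludes an interior
    maximum; then [e] tends to [0]. *)
Lemma harmonic_le U r c T : 0 < r -> open U -> [set x | enorm x <= r] `<=` U ->
  Cn_on 2 U T -> (forall x, eball r x -> laplacian T x = 0) ->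
  (forall x, enorm x = r -> T x <= c) -> forall x, eball r x -> T x <= c.
Proof.
move=> r0 oU KU cT hT Tc x xr; apply/ler_addgt0Pr => e' e'0.
(* The correction [e * |x| ^ 2] is then at most [e'] on the ball. *)
pose e := e' / r ^+ 2; have e0 : 0 < e by rewrite divr_gt0 ?exprn_gt0.
pose f y := T y + e * dot y y.
have dotE v y h : dot (h *: v + y) (h *: v + y) =
    h ^+ 2 * dot v v + 2 * h * dot y v + dot y y.
  by rewrite !(dotDl, dotDr, dotZl, dotZr) (dotC v y); ring.
have K0 : [set y : E | enorm y <= r] !=set0 by exists 0; rewrite /= enorm0 ltW.
have Kc : compact [set y : E | enorm y <= r].
  apply: bounded_closed_compact; last exact: closed_enorm_le.
  have [M [Mr BM]] := @eball_bounded R (r + 1).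
  exists M; split=> // k' Mk y /= yr; apply: (BM k' Mk).
  by rewrite /eball/= (le_lt_trans yr)// ltrDl.
have cf : {within [set y : E | enorm y <= r], continuous f}.
  apply: continuous_in_subspaceT => y; rewrite inE => /KU Uy.
  have cT' := Cn_on_continuous cT Uy.
  have cn : {for y, continuous (fun y : E => e * dot y y)}.
    have -> : (fun y : E => e * dot y y) = (fun y => e * enorm y ^+ 2).
      by apply/funext => z; rewrite enorm_sqr.
    apply: (@continuousM _ _ (cst e) (fun z : E => enorm z ^+ 2)).
      exact: cst_continuous.
    apply: (@continuous_comp _ _ _ (@enorm R) (fun t => t ^+ 2)).
      exact: enorm_continuous.
    exact: exprn_continuous.
  exact: (continuousD cT' cn).
have [m] := EVT_max_rV K0 Kc cf; rewrite inE/= => mr fm.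
have mE : enorm m = r.
  apply/eqP; rewrite eq_le mr leNgt; apply/negP => mr'.
  have Um : U m by exact: KU.
  have near_line v : \forall h \near (0 : R), eball r (h *: v + m).
    have : h *: v + m @[h --> (0 : R)] --> m.
      rewrite -[X in _ --> X]add0r; apply: cvgD; last exact: cvg_cst.
      by rewrite -[X in _ --> X](scale0r v); apply: cvgZl; exact: cvg_id.
    by apply; apply: open_nbhs_nbhs; split=> //; exact: eball_open.
  have snd i : partial i (partial i T) m + 2 * e <= 0.
    pose v := basis_vec i : E.
    have vv : dot v v = 1 by rewrite dot_basis mxE !eqxx.
    apply: (@second_derive_at_max _ (fun h => f (h *: v + m))
      (fun h => 'D_v T (h *: v + m) + e * (2 * h + 2 * dot m v))).
    - near=> h; rewrite scale0r add0r; apply: fm; rewrite inE/= ltW//.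
      by near: h; exact: near_line.
    - near=> h; rewrite /f; have Uh : U (h *: v + m).
        by apply: KU; apply/ltW; near: h; exact: near_line.
      apply: is_deriveD; first exact: is_derive_line (Cn_on_is_derive v cT Uh).
      under [X in is_derive _ _ X]eq_fun do rewrite dotE vv mulr1.
      exact: is_derive_affine_sqr.
    - apply: is_deriveD.
        apply: (@is_derive_line _ _ _ ('D_v T) m v 0); rewrite scale0r add0r.
        exact: Cn_on_is_derive (Cn_on_derive v cT) Um.
      have d := is_deriveZ e (is_deriveD (is_deriveZ 2 (is_derive_id (0 : R) (1 : R)))
        (is_derive_cst (2 * dot m v) (0 : R) (1 : R))).
      apply: (is_derive_eq d); rewrite addr0 -![_ *: _]/(_ * _); ring.
  have : laplacian T m + 6 * e <= 0.
    rewrite (_ : 6 * e = \sum_(i < 3) 2 * e); last first.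
      by rewrite sumr_const card_ord -mulr_natl; ring.
    by rewrite -big_split/=; apply: sumr_le0 => i _; exact: snd.
  by rewrite hT// add0r leNgt mulr_gt0.
have xK : x \in [set y : E | enorm y <= r] by rewrite inE; exact: ltW.
have := fm _ xK; rewrite /f -!enorm_sqr mE.
have -> : e * r ^+ 2 = e' by rewrite divfK// gt_eqF// exprn_gt0.
have := Tc _ mE; have : 0 <= e * enorm x ^+ 2 by rewrite mulr_ge0 ?sqr_ge0// ltW.
by lra.
Unshelve. all: by end_near. Qed.

Lemma harmonic_eq_boundary U r c T : 0 < r -> open U -> [set x | enorm x <= r] `<=` U ->
  Cn_on 2 U T -> (forall x, eball r x -> laplacian T x = 0) ->
  (forall x, enorm x = r -> T x = c) -> forall x, eball r x -> T x = c.
Proof.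
move=> r0 oU KU cT hT Tc x xr; apply/eqP; rewrite eq_le; apply/andP; split.
  by apply: (harmonic_le r0 oU KU cT hT) xr => y /Tc ->.
rewrite -[T x]opprK -lerN2 opprK.
have pN i y : U y -> partial i (fun z => - T z) y = - partial i T y.
  by move=> Uy; rewrite /partial deriveN//; case: (Cn_on_is_derive (basis_vec i) cT Uy).
apply: (@harmonic_le U r (- c) (fun z => - T z) r0 oU KU _ _ _ x xr).
- apply: (@Cn_on_ext _ _ _ oU _ _ (fun z => -1 * T z)) => [y _|]; first by rewrite mulN1r.
  by apply: (Cn_onM oU (f := cst (-1 : R)) (g := T) _ cT); exact: Cn_on_cst.
- move=> y yr; have Uy : U y by apply/KU/ltW.
  transitivity (- laplacian T y); last by rewrite hT// oppr0.
  rewrite /laplacian -sumrN; apply: eq_bigr => i _.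
  rewrite {1}/partial (derive_eq_on_open _ oU (pN i) Uy) deriveN//.
  by case: (Cn_on_is_derive (basis_vec i) (Cn_on_derive (basis_vec i) cT) Uy).
- by move=> y /Tc ->.
Qed.

End MaximumPrinciple.

(** * Equilibria of the model *)

Section RestState.
Context {R : realType} (c : constants R).
Local Notation E := 'rV[R]_3.
Local Notation e1 := (@basis_vec R ord0).

(** The density at which the gas, at temperature [T_c], exerts the pressure
    [rest_pressureE] that balances the two surface tensions. *)
Definition rest_density (V r : R) : R :=
  2 / (gas_const c * T_c c) * (sigma c / r + sigma_bar c / outer_radius V r).

Definition rest_pressure (V r : R) : R := gas_const c * T_c c * rest_density V r.

Definition rest_state (V r : R) : flow R := {|
  gas := fun _ => eball r;
  liquid := fun _ => shell r (outer_radius V r);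
  v_l := fun _ _ => 0;
  p_l := fun _ _ => 2 * sigma_bar c / outer_radius V r;
  rho := fun _ _ => rest_density V r;
  v_g := fun _ _ => 0;
  p_g := fun _ => rest_pressure V r;
  T_g := fun _ _ => T_c c;
  entropy := fun _ _ =>
    spec_heat c * ln (rest_pressure V r / (rest_density V r `^ gamma c)) |}.

Lemma rest_density_gt0 V r : 0 < V -> 0 < r -> 0 < rest_density V r.
Proof.
move=> V0 r0; have b0 := outer_radius_gt0 V0 r0.
have := (T_c_gt0 c, gas_const_gt0 c, sigma_gt0 c, sigma_bar_gt0 c) => -[[[T0 g0] s0] sb0].
by rewrite mulr_gt0 ?divr_gt0 ?addr_gt0 ?mulr_gt0 ?invr_gt0.
Qed.

Lemma rest_pressureE V r :
  rest_pressure V r = 2 * sigma c / r + 2 * sigma_bar c / outer_radius V r.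
Proof.
rewrite /rest_pressure /rest_density mulrA [_ * (2 / _)]mulrC divfK; first by ring.
by rewrite mulf_neq0// gt_eqF ?gas_const_gt0 ?T_c_gt0.
Qed.

Lemma partial_cst {W : normedModType R} i (w : W) (x : E) : partial i (cst w) x = 0.
Proof. exact: derive_cst. Qed.

Lemma laplacian_cst {W : normedModType R} (w : W) (x : E) : laplacian (cst w) x = 0.
Proof.
rewrite /laplacian big1// => i _; rewrite (_ : partial i (cst w) = cst 0) ?partial_cst//.
by apply/funext => y; exact: (partial_cst i w).
Qed.

Lemma grad_cst (w : R) (x : E) : grad (cst w) x = 0.
Proof. by apply/rowP => i; rewrite !mxE partial_cst. Qed.

Lemma div_cst (w x : E) : div (cst w) x = 0.
Proof. by rewrite /div big1// => i _; exact: (partial_cst i (w ord0 i)). Qed.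

Lemma sym_grad_cst (w x : E) : sym_grad (cst w) x = 0.
Proof.
apply/matrixP => i j; rewrite !mxE.
by rewrite !(partial_cst _ (w ord0 _)) addr0 mul0r.
Qed.

Lemma normal_velocity_static (A : R -> set E) t x :
  (forall u, A u = A t) -> normal_velocity A t x = 0.
Proof.
move=> At; rewrite /normal_velocity (_ : (fun u => _) = cst (signed_distance (A t) x)).
  by rewrite derive1_cst oppr0.
by apply/funext => u; rewrite At.
Qed.

Lemma closure_eball_shell r b : 0 < r -> r < b ->
  closure (@eball R r) `|` shell r b = eball b.
Proof.
move=> r0 rb; rewrite closure_eball//; apply/seteqP; split=> x /=.
  by case=> [xr|/andP[]//]; exact: le_lt_trans rb.
by move=> xb; have [xr|rx] := leP (enorm x) r; [left|right; rewrite /shell/= rx].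
Qed.

Lemma smooth_up_to_boundary_cst {W : normedModType R} (A : set E) (w : W) :
  smooth_up_to_boundary A (cst w).
Proof.
exists setT; split; [exact: openT|by []|move=> n].
by apply: Cn_on_cst; exact: openT.
Qed.

Lemma shell_domain a b : 0 < a -> a < b -> is_domain (@shell R a b).
Proof.
move=> a0 ab; split; [exact: shell_open|exact: shell_connected| |].
  exists (((a + b) / 2) *: e1); rewrite /shell/= enorm_ray; first by apply/andP; split; lra.
  by lra.
have [M [Mr BM]] := @eball_bounded R b.
by exists M; split=> // k Mk y /andP[_ yb]; exact: (BM k Mk).
Qed.

(** Everything is constant and at rest, so the content is geometric: the shell is a domain
    of the right volume and the two curvatures balance the pressure jumps. *)
Lemma rest_state_equilibrium V r : 0 < V -> 0 < r -> equilibrium c V (rest_state V r).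
Proof.
move=> V0 r0; have rb := outer_radius_gt V0 r0; have b0 := outer_radius_gt0 V0 r0.
have bE := outer_radius_cubed V0 r0; have q0 := rest_density_gt0 V0 r0.
set b := outer_radius V r in rb b0 bE.
have regE t : region (rest_state V r) t = eball b by exact: closure_eball_shell.
split.
- move=> t; split.
  + split => /=.
    * split; last exact: shell_domain.
      split; [exact: eball_open|exact: eball_connected| |exact: eball_bounded].
      by exists 0; rewrite /eball/= enorm0.
    * apply/seteqP; split=> x //= -[xr /andP[rx _]].
      by move: (lt_trans rx xr); rewrite ltxx.
    * by rewrite regE; exact: eball_open.
    * rewrite volume_shell// bE addrAC subrr add0r /V_bar; congr EFin.
      by have := pi_gt0 R; move: pi => p p0; field; rewrite gt_eqF.
  + move=> x _; split => /=; last exact: div_cst.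
    rewrite derive1_cst laplacian_cst grad_cst scaler0 subr0 addr0 add0r.
    by rewrite /advect big1 ?scaler0// => i _; rewrite mxE scale0r.
  + move=> x _; split => //=.
    * rewrite derive1_cst add0r (_ : (fun y => _) = cst 0) ?div_cst//.
      by apply/funext => y; rewrite scaler0.
    * rewrite derive1_cst grad_cst add0r (_ : (fun y => _) = cst 0) ?div_cst.
        by rewrite /dot big1 ?mulr0// => i _; rewrite mxE mul0r.
      by apply/funext => y; rewrite grad_cst scaler0.
  + move=> x /=; rewrite boundary_eball//= => xr.
    have x0 : x != 0 by rewrite -enorm_gt0 xr.
    have dot0 u : dot (0 : E) u = 0 by rewrite /dot big1// => i _; rewrite mxE mul0r.
    split=> //=; rewrite ?dot0 ?normal_velocity_static//.
    rewrite sym_grad_cst mulmx0 scaler0 addr0 curvature_eball// rest_pressureE addrK xr.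
    by congr (_ *: _); ring.
  + move=> x /= [+ nx]; rewrite boundary_shell//= => -[xr|xb].
      by case: nx; rewrite boundary_eball.
    have x0 : x != 0 by rewrite -enorm_gt0 xb.
    have dot0 u : dot (0 : E) u = 0 by rewrite /dot big1// => i _; rewrite mxE mul0r.
    split=> /=; first by rewrite dot0 normal_velocity_static// => u; rewrite !regE.
    rewrite sym_grad_cst mulmx0 scaler0 addr0 regE curvature_eball// xb.
    by congr (_ *: _); rewrite -/b; ring.
- move=> t; split=> /=.
  + by exists r; split.
  + by split; exists (fun=> 0) => x _; rewrite mul0r scale0r.
  + by exists (fun=> 2 * sigma_bar c / b).
  + by split; eexists (fun=> _) => x _.
- move=> t; split=> //=; do ?split; exact: smooth_up_to_boundary_cst.
- by move=> t u; split.
Qed.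

End RestState.

(** * Rigidity of equilibria *)

Section EquilibriumStructure.
Context {R : realType} (c : constants R).
Local Notation E := 'rV[R]_3.
Local Notation e1 := (@basis_vec R ord0).
Variables (V : R) (f : flow R) (t r : R).
Hypotheses (V0 : 0 < V) (eqf : equilibrium c V f) (r0 : 0 < r).
Hypotheses (gasE : gas f t = eball r) (regE : region f t = eball (outer_radius V r)).
Local Notation b := (outer_radius V r).

Let rb : r < b. Proof. exact: outer_radius_gt. Qed.
Let b0 : 0 < b. Proof. exact: outer_radius_gt0. Qed.

Lemma derive1_static {W : normedModType R} (F : R -> W) : (forall u, F u = F t) ->
  derive1 F t = 0.
Proof.
by move=> Ft; rewrite (_ : F = cst (F t)) ?derive1_cst//; apply/funext => u; rewrite Ft.
Qed.

(** The liquid, being open and disjoint from the gas, also avoids the closure of the gas, so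
    it is determined by the gas and by the whole region. *)
Lemma equilibrium_liquid : liquid f t = shell r b.
Proof.
have [sol _ _ _] := eqf; have [[[_ [oL _ _ _]] disj _ _] _ _ _ _] := sol t.
have disjc x : liquid f t x -> r < enorm x.
  move=> Lx; rewrite ltNge; apply/negP => xr.
  have : closure (gas f t) x by rewrite gasE closure_eball.
  move=> /(_ _ (open_nbhs_nbhs (conj oL Lx))) [y [gy Ly]].
  by have : (gas f t `&` liquid f t) y by []; rewrite disj.
have regP x : region f t x <-> enorm x < b by rewrite regE.
apply/seteqP; split=> x.
  by move=> Lx; rewrite /shell/= disjc//=; apply/regP; right.
move=> /andP[rx xb]; have /regP[|//] := xb.
by rewrite gasE closure_eball//= leNgt rx.
Qed.

Let closureL : closure (liquid f t) = [set x | r <= enorm x <= b].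
Proof. by rewrite equilibrium_liquid closure_shell. Qed.

Let closureG : closure (gas f t) = [set x | enorm x <= r].
Proof. by rewrite gasE closure_eball. Qed.

Let statics u : [/\ gas f u = gas f t, liquid f u = liquid f t, region f u = region f t &
  p_g f u = p_g f t].
Proof.
have [_ _ _ /(_ u t) [gu lu pu _ _]] := eqf.
by split=> //; rewrite /region gu lu.
Qed.

Let gas_velocity x : normal_velocity (gas f) t x = 0.
Proof. by apply: normal_velocity_static => u; case: (statics u). Qed.

Let region_velocity x : normal_velocity (region f) t x = 0.
Proof. by apply: normal_velocity_static => u; case: (statics u). Qed.

Let ray_neq0 s : 0 < s -> s *: e1 != 0.
Proof. by move=> s0; rewrite -enorm_gt0 enorm_ray// ltW. Qed.

Let normal_ray s : 0 < s -> normal (@eball R s) (s *: e1) = e1.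
Proof.
move=> s0; rewrite normal_eball// ?ray_neq0// enorm_ray ?ltW//.
by rewrite scalerA mulVf ?scale1r// gt_eqF.
Qed.

Let gas_bc : gas_boundary_conditions c f t (r *: e1).
Proof.
have [sol _ _ _] := eqf; have [_ _ _ bc _] := sol t; apply: bc.
by rewrite gasE boundary_eball//= enorm_ray// ltW.
Qed.

Let outer_bc : outer_boundary_conditions c f t (b *: e1).
Proof.
have [sol _ _ _] := eqf; have [_ _ _ _ bc] := sol t; apply: bc.
rewrite equilibrium_liquid gasE boundary_shell// boundary_eball//=.
rewrite enorm_ray; last exact: ltW.
split; first by right.
by move=> br; move: rb; rewrite br ltxx.
Qed.

(** An incompressible radial flow that does not cross the outer sphere vanishes. *)
Lemma equilibrium_v_l x : liquid f t x -> v_l f t x = 0.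
Proof.
have [sol sym reg _] := eqf; have [_ leq _ _ _] := sol t.
have [_ [rv _] _ _] := sym t; have [_ [[U [oU LU sU]] _] _ _ _] := reg t.
rewrite equilibrium_liquid in leq rv *; apply: (radial_div_free_eq0 oU (ltW r0) rb _ _ rv).
- move=> s /andP[rs sb]; apply: LU; rewrite closureL/= enorm_ray ?sb ?ltW//.
  exact: lt_trans rs.
- by move=> i; apply: Cn_on_coord; last exact: sU.
- by move=> y /leq[].
- by have [] := outer_bc; rewrite regE normal_ray// region_velocity dot_basis.
Qed.

(** The divergence-free field is the mass flux; the origin, excluded from the shell of inner
    radius [0], is treated apart. *)
Lemma equilibrium_v_g x : gas f t x -> v_g f t x = 0.
Proof.
have [sol sym reg ti] := eqf; have [_ _ geq _ _] := sol t.
have [_ [_ [g gv]] _ [[q rq] _ _]] := sym t.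
have [rho0 _ [U1 [oU1 GU1 sU1]] [U2 [oU2 GU2 sU2]] _] := reg t.
pose U := U1 `&` U2; have oU : open U by exact: openI.
have GU y : closure (gas f t) y -> U y by move=> Gy; split; [exact: GU1|exact: GU2].
pose u y := rho f t y *: v_g f t y.
have Cn_sub n (A : set E) (W : normedModType R) (h : E -> W) :
    U `<=` A -> Cn_on n A h -> Cn_on n U h.
  move=> UA; elim: n h => [|n IH] h [ch dh]; split; do ?by move=> y /UA; exact: ch.
    by [].
  by move=> v; have [dv cv] := dh v; split; [move=> y /UA; exact: dv|exact: IH].
have gasP y : gas f t y <-> enorm y < r by rewrite gasE.
have u0 y : shell 0 r y -> u y = 0.
  apply: (@radial_div_free_eq0 _ U 0 r u oU (lexx 0) r0).
  - move=> s /andP[s0 sr]; apply: GU; rewrite closureG/= enorm_ray//; exact: ltW.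
  - move=> i; have -> : (fun y => u y ord0 i) = fun y => rho f t y * v_g f t y ord0 i.
      by apply/funext => z; rewrite mxE.
    apply: (Cn_onM oU (f := rho f t) (g := fun y => v_g f t y ord0 i)).
      by apply: Cn_sub (sU1 1%N) => z [].
    by apply: Cn_on_coord => //; apply: Cn_sub (sU2 1%N) => z [].
  - exists (fun s => q s * g s) => z /andP[_ zr].
    by rewrite /u gv ?rq; try exact/gasP; rewrite scalerA mulrA.
  - move=> z /andP[_ zr]; have [+ _ _ _] := geq z ((gasP z).2 zr).
    rewrite derive1_static ?add0r// => w.
    have [_ _ _ _ /(_ z)[]] := ti w t => //.
    have [-> _ _ _] := statics w.
    by rewrite closureG/= ltW.
  - have [_ + _ _] := gas_bc; rewrite gas_velocity gasE normal_ray// dot_basis.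
    by rewrite /u mxE => ->; rewrite mulr0.
move=> Gx; have [->|x0] := eqVneq x 0; first by rewrite gv ?scaler0//; apply/gasP; rewrite enorm0.
have : rho f t x *: v_g f t x = 0.
  by apply/u0; rewrite /shell/= enorm_gt0 x0/=; apply/gasP.
by move=> /eqP; rewrite scaler_eq0 gt_eqF ?rho0//= => /eqP.
Qed.

(** Without motion the energy equation says that the temperature is harmonic. *)
Lemma equilibrium_T_g x : gas f t x -> T_g f t x = T_c c.
Proof.
have [sol _ reg ti] := eqf; have [_ _ geq bc _] := sol t.
have [_ _ _ _ [[U [oU GU sU]] _]] := reg t.
have gasP y : gas f t y <-> enorm y < r by rewrite gasE.
move=> /gasP; apply: (harmonic_eq_boundary r0 oU _ (sU 2%N)).
- by rewrite -closureG.
- move=> y yr; have Gy : gas f t y by rewrite gasE.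
  have Uy : U y by apply: GU; exact: subset_closure.
  have [_ + _ _] := geq y Gy; rewrite equilibrium_v_g//.
  rewrite derive1_static => [|w]; last first.
    have [_ _ _ _ /(_ y)[]] := ti w t => //.
    have [-> _ _ _] := statics w; exact: subset_closure.
  rewrite add0r [dot 0 _]big1 ?mulr0 => [|i _]; last by rewrite mxE mul0r.
  move=> /esym; rewrite /div.
  have dE i : partial i (fun z => (kappa c *: grad (T_g f t) z) ord0 i) y =
      kappa c * partial i (partial i (T_g f t)) y.
    have -> : (fun z => (kappa c *: grad (T_g f t) z) ord0 i) =
        kappa c \*: partial i (T_g f t).
      by apply/funext => z; rewrite !mxE.
    rewrite /partial deriveZ//.
    by have [] := Cn_on_is_derive (basis_vec i) (Cn_on_derive (basis_vec i) (sU 2%N)) Uy.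
  rewrite (eq_bigr _ (fun i _ => dE i)) -mulr_sumr => /eqP.
  by rewrite mulf_eq0 gt_eqF ?kappa_gt0//= => /eqP.
- move=> y yr; have [|_ _ _ -> //] := bc y.
  by rewrite gasE boundary_eball.
Qed.

(** Without motion the momentum equation says that the pressure has zero gradient; being
    radial, it is determined by its values on one ray. *)
Lemma equilibrium_p_l x : closure (liquid f t) x -> p_l f t x = p_l f t (b *: e1).
Proof.
have [sol sym reg ti] := eqf; have [_ leq _ _ _] := sol t.
have [_ _ [g pg] _] := sym t; have [_ [_ [U [oU LU sU]]] _ _ _] := reg t.
have oL : open (liquid f t) by rewrite equilibrium_liquid; exact: shell_open.
have gradp y : liquid f t y -> grad (p_l f t) y = 0.
  move=> Ly; have [+ _] := leq y Ly.
  rewrite derive1_static => [|w]; last first.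
    have [_ _ _ /(_ y) h _] := ti w t; have [] := h => //.
    have [_ -> _ _] := statics w; exact: subset_closure.
  have -> : advect (v_l f t) (v_l f t) y = 0.
    by rewrite /advect big1// => i _; rewrite equilibrium_v_l// mxE scale0r.
  have -> : laplacian (v_l f t) y = 0.
    rewrite /laplacian big1// => i _.
    have d0 z : liquid f t z -> partial i (v_l f t) z = (cst 0) z.
      move=> Lz; rewrite /partial (derive_eq_on_open _ oL (g := cst 0) equilibrium_v_l Lz).
      exact: derive_cst.
    by rewrite {1}/partial (derive_eq_on_open _ oL d0 Ly) derive_cst.
  by rewrite addr0 !scaler0 subr0 add0r.
have cp s : r < s <= b -> {for s, continuous (fun s : R => p_l f t (s *: e1))}.
  move=> /andP[rs sb]; apply: continuous_ray; apply: Cn_on_continuous (sU 0%N) _.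
  by apply: LU; rewrite closureL/= enorm_ray ?(ltW rs)// ltW// (lt_trans r0).
have ray s : r < s <= b -> p_l f t (s *: e1) = p_l f t (b *: e1).
  move=> sI; apply: (zero_derive_constant rb cp) sI => u /andP[ru ub].
  have Lu : liquid f t (u *: e1).
    by rewrite equilibrium_liquid /shell/= enorm_ray ?ru// ltW// (lt_trans r0).
  have Uu : U (u *: e1) by apply: LU; exact: subset_closure.
  have := is_derive_ray (Cn_on_is_derive e1 (sU 1%N) Uu).
  by have /rowP/(_ ord0) := gradp _ Lu; rewrite !mxE /partial -/e1 => ->.
move=> Lx; have cx : {for x, continuous (p_l f t)} by apply: Cn_on_continuous (sU 0%N) (LU _ Lx).
have c0 : {for x, continuous (cst (p_l f t (b *: e1)) : E -> R)} by exact: cst_continuous.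
apply: (closure_limit_eq cx c0 Lx) => y Ly; rewrite /cst.
have : shell r b y by rewrite -equilibrium_liquid.
move=> /andP[ry yb]; rewrite -(ray (enorm y)) ?ry ?ltW// !pg//.
  by rewrite enorm_ray ?enorm_ge0.
by rewrite equilibrium_liquid /shell/= enorm_ray ?enorm_ge0 ?ry.
Qed.

Lemma equilibrium_sym_grad x : closure (liquid f t) x -> sym_grad (v_l f t) x = 0.
Proof.
have [_ _ reg _] := eqf; have [_ [[U [oU LU sU]] _] _ _ _] := reg t => Lx.
have oL : open (liquid f t) by rewrite equilibrium_liquid; exact: shell_open.
have d0 i : partial i (v_l f t) x = 0.
  exact: Cn_on_cst_derive_closure oL LU (sU 1%N) equilibrium_v_l Lx.
have dv i : derivable (v_l f t) x (basis_vec i).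
  by case: (Cn_on_is_derive (basis_vec i) (sU 1%N) (LU _ Lx)).
by apply/matrixP => i j; rewrite !mxE !partial_coord// !d0 !mxE addr0 mul0r.
Qed.

(** With the viscous stress gone, one point of each sphere gives the jump conditions. *)
Lemma equilibrium_pressures : p_l f t (b *: e1) = 2 * sigma_bar c / b /\
  p_g f t = rest_pressure c V r.
Proof.
have Lb : closure (liquid f t) (b *: e1).
  by rewrite closureL/= enorm_ray ?(ltW rb) ?lexx// ltW.
have Lr : closure (liquid f t) (r *: e1).
  by rewrite closureL/= enorm_ray ?(ltW rb) ?lexx// ltW.
have pl : p_l f t (b *: e1) = 2 * sigma_bar c / b.
  have [_] := outer_bc; rewrite regE normal_ray// curvature_eball ?ray_neq0//.
  rewrite equilibrium_sym_grad// mulmx0 scaler0 addr0 enorm_ray ?ltW//.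
  move=> /rowP/(_ ord0); rewrite !mxE !eqxx !mulr1 => h.
  by rewrite -[LHS]opprK h; ring.
split=> //; have [_ _ + _] := gas_bc.
rewrite gasE normal_ray// curvature_eball ?ray_neq0//.
rewrite equilibrium_sym_grad// mulmx0 scaler0 addr0 enorm_ray ?ltW//.
rewrite (equilibrium_p_l Lr) pl => /rowP/(_ ord0); rewrite !mxE !eqxx !mulr1 => h.
by rewrite -[LHS](subrK (2 * sigma_bar c / b)) h rest_pressureE; ring.
Qed.

Lemma equilibrium_rho x : gas f t x -> rho f t x = rest_density c V r.
Proof.
have [sol _ _ _] := eqf; have [_ _ geq _ _] := sol t => Gx.
have [_ _ + _] := geq x Gx; rewrite equilibrium_T_g// equilibrium_pressures.2.
rewrite /rest_pressure => /(mulfI _) -> //.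
by rewrite mulf_neq0// gt_eqF ?gas_const_gt0 ?T_c_gt0.
Qed.

Lemma equilibrium_same_state u : same_state f t (rest_state c V r) u.
Proof.
have [sol _ reg _] := eqf; have [_ _ geq _ _] := sol t.
have [_ [[Uv [_ LUv sUv]] _] [Ur [_ GUr sUr]] [Ug [_ GUg sUg]] ] := reg t.
move=> [[UT [_ GUT sUT]] [Us [_ GUs sUs]]].
have ext (W : normedModType R) (A U : set E) (h : E -> W) w x : closure A `<=` U ->
    smooth_on U h -> (forall y, A y -> h y = w) -> closure A x -> h x = w.
  move=> AU sh hw Ax.
  have ch : {for x, continuous h} by exact: Cn_on_continuous (sh 0%N) (AU _ Ax).
  have cw : {for x, continuous (cst w : E -> W)} by exact: cst_continuous.
  exact: (closure_limit_eq ch cw Ax).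
split=> /=.
- exact: gasE.
- exact: equilibrium_liquid.
- exact: equilibrium_pressures.2.
- move=> x Lx; split; first exact: ext LUv sUv equilibrium_v_l Lx.
  by rewrite equilibrium_p_l// equilibrium_pressures.1.
- move=> x Gx; split.
  + exact: ext GUr sUr equilibrium_rho Gx.
  + exact: ext GUg sUg equilibrium_v_g Gx.
  + exact: ext GUT sUT equilibrium_T_g Gx.
  + apply: ext GUs sUs _ Gx => y Gy; have [_ _ _ ->] := geq y Gy.
    by rewrite equilibrium_rho// equilibrium_pressures.2.
Qed.

End EquilibriumStructure.

Lemma equilibrium_is_rest {R : realType} (c : constants R) V f : 0 < V ->
  equilibrium c V f ->
  exists2 r, 0 < r & forall t u, same_state f t (rest_state c V r) u.
Proof.
move=> V0 eqf; have [_ sym _ ti] := eqf.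
have [[r [[r0 g0] _]] _ _ _] := sym 0.
exists r => // t u; have [[r' [[r'0 gE] rE]] _ _ _] := sym t.
suff e : r' = r by subst r'; exact: equilibrium_same_state.
have [gt _ _ _ _] := ti t 0.
by apply: eball_inj => //; rewrite -gE -g0 gt.
Qed.

(** * Mass and volume parametrize the equilibria *)

Section MassVolume.
Context {R : realType} (c : constants R).

Definition rest_mass (V r : R) : R := 4 * pi / 3 * r ^+ 3 * rest_density c V r.

Lemma rest_mass_gt0 V r : 0 < V -> 0 < r -> 0 < rest_mass V r.
Proof.
move=> V0 r0; have := rest_density_gt0 c V0 r0; have := pi_gt0 R => p0 q0.
by apply: mulr_gt0 => //; rewrite !mulr_gt0 ?invr_gt0 ?exprn_gt0.
Qed.

Lemma R_dag_rest_mass V r : 0 < V -> 0 < r -> R_dag c (rest_mass V r) V = r.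
Proof.
move=> V0 r0; apply: R_dag_unique => //; first exact: rest_mass_gt0.
by have [_] := @radius_fun_pressure _ c _ _ _ (rest_density c V r) V0 r0 erefl; apply.
Qed.

Lemma rho_dag_rest_mass V r : 0 < V -> 0 < r ->
  rho_dag c (rest_mass V r) V = rest_density c V r.
Proof.
move=> V0 r0; have M0 := rest_mass_gt0 V0 r0.
by rewrite rho_dag_pressure// R_dag_rest_mass.
Qed.

Lemma rest_state_dag M V : 0 < M -> 0 < V ->
  rest_density c V (R_dag c M V) = rho_dag c M V.
Proof. by move=> M0 V0; rewrite rho_dag_pressure. Qed.

Lemma same_state_common (f g h : flow R) t u w :
  same_state f t h w -> same_state g u h w -> same_state f t g u.
Proof.
move=> [gf lf pf Lf Gf] [gg lg pg Lg Gg].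
split; rewrite ?gf ?lf ?pf//.
  move=> x Lx; have [|-> ->] := Lf x; first by rewrite lf.
  by have [|-> ->] := Lg x; first by rewrite lg.
move=> x Gx; have [|-> -> -> ->] := Gf x; first by rewrite gf.
by have [|-> -> -> ->] := Gg x; first by rewrite gg.
Qed.

Lemma equilibrium_dag V f : 0 < V -> equilibrium c V f ->
  exists2 r, 0 < r & [/\ forall t u, same_state f t (rest_state c V r) u,
    forall t, gas_mass f t = (rest_mass V r)%:E,
    forall t, gas_radius f t r & forall t, gas_density f t (rest_density c V r)].
Proof.
move=> V0 eqf; have [r r0 rest] := equilibrium_is_rest V0 eqf.
have dens t : gas_density f t (rest_density c V r).
  have [_ _ _ _ gas_eq] := rest t 0.
  by move=> x Gx; have [|-> _ _ _] := gas_eq x; first exact: subset_closure.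
have gasE t : gas f t = eball r by case: (rest t 0).
exists r => //; split=> // t.
rewrite /gas_mass gasE (integral3_eball_cst r0 (q := rest_density c V r))//.
by move=> x Bx; apply: dens; rewrite gasE.
Qed.

(** The gas radius and density of an equilibrium of volume [V] and radius [r] are the image
    of [(rest_mass V r, V)]. *)
Lemma dag_map_bij : set_bij (@quadrant R) (equilibrium_pairs c) (dag_map c).
Proof.
split.
- move=> [M V] [/= M0 V0]; exists V, (rest_state c V (R_dag c M V)).
  have x0 := R_dag_gt0 c M0 V0.
  split=> //; first exact: rest_state_equilibrium.
  by move=> t; split=> // x _ /=; exact: rest_state_dag.
- move=> [M V] [M' V'] /[!inE] -[/= M0 V0] [/= M'0 V'0]; exact: dag_map_inj.
- move=> [x q] [V [f [V0 eqf xq]]] /=.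
  have [r r0 [_ _ rad dens]] := equilibrium_dag V0 eqf.
  have [[x0 gx] dx] := xq 0; have [_ gr] := rad 0; have dr := dens 0.
  have xr : x = r by apply: eball_inj => //; rewrite -gx -gr.
  have qE : q = rest_density c V r.
    have G0 : gas f 0 0 by rewrite gr /eball/= enorm0.
    exact: etrans (esym (dx 0 G0)) (dr 0 G0).
  exists (rest_mass V r, V); first by split=> //=; exact: rest_mass_gt0.
  by rewrite /dag_map/= R_dag_rest_mass// rho_dag_rest_mass// xr qE.
Qed.

End MassVolume.

Theorem theorem1p1 (R : realType) (c : constants R) :
  (forall M V : R, 0 < M -> 0 < V ->
    [/\ exists! x : R, 0 < x /\ root (radius_poly c M V) x,
        Num.sqrt (3 * gas_const c * T_c c * M / (8 * pi * sigma c))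
          / Num.sqrt (1 + sigma_bar c / sigma c) < R_dag c M V,
        R_dag c M V
          < Num.sqrt (3 * gas_const c * T_c c * M / (8 * pi * sigma c)) &
        rho_dag c M V
          = 2 / (gas_const c * T_c c) *
            (sigma c / R_dag c M V
             + sigma_bar c / (R_dag c M V ^+ 3 + V_bar V) `^ (3^-1))]) /\
  smooth_on (@quadrant R) (dag_map c) /\
  set_bij (@quadrant R) (equilibrium_pairs c) (dag_map c) /\
  (forall (V : R) (f : flow R), 0 < V -> equilibrium c V f ->
    exists M : R, 0 < M /\ forall t : R,
      [/\ gas_mass f t = M%:E,
          gas_radius f t (R_dag c M V) &
          gas_density f t (rho_dag c M V)]) /\
  (forall (V : R) (f g : flow R), 0 < V ->
    equilibrium c V f -> equilibrium c V g ->
    (forall t : R, gas_mass f t = gas_mass g t) ->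
    forall t : R, same_state f t g t).
Proof.
split.
  move=> M V M0 V0; have /andP[lo hi] := R_dag_bounds c M0 V0.
  by split; [exact: radius_poly_root_unique|exact: lo|exact: hi|exact: rho_dag_pressure].
split; first exact: dag_map_smooth.
split; first exact: dag_map_bij.
split=> [V f V0 eqf|V f g V0 eqf eqg mfg t].
  have [r r0 [_ mass rad dens]] := equilibrium_dag V0 eqf.
  exists (rest_mass c V r); split; first exact: rest_mass_gt0.
  by move=> t; rewrite R_dag_rest_mass// rho_dag_rest_mass.
have [r r0 [restf mf _ _]] := equilibrium_dag V0 eqf.
have [r' r'0 [restg mg _ _]] := equilibrium_dag V0 eqg.
have e : r' = r.
  have eM : rest_mass c V r = rest_mass c V r'.
    by apply: EFin_inj; rewrite -(mf t) -(mg t).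
  by rewrite -(R_dag_rest_mass c V0 r0) eM R_dag_rest_mass.
by subst r'; exact: same_state_common (restf t t) (restg t t).
Qed.
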